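(* Let $\beta,h\in\mathbb R$ be fixed. Suppose there is a finite constant $\gamma>0$ (independent of $N$) with $\max_{i\in[N]}\sum_{j,k}A_{ijk}\le\gamma$ for all $N$, and that the mean-field condition $$\Big\|\sum_iA_i^2\Big\|_{\mathrm{op}}=o\big((\log N)^{-1}\big)$$ holds. Then: (i) The model $P_{\beta,h}$ is mean-field, in the sense that $$\log Z_N(\beta,h)-\sup_{t\in[\kappa_-,\kappa_+]^N}\big(f(t)-I(t)\big)=o(N).$$ (ii) The set of all conditional mean vectors $\mathcal M_N=\{b(x):x\in[\kappa_-,\kappa_+]^N\}$ has low complexity: for every $\delta>0$ there exists a $\delta\sqrt N$-net $\mathcal D_N(\delta)$ of $\mathcal M_N$ in the Euclidean metric with $\log|\mathcal D_N(\delta)|=o(N)$.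
   Context: Setting. $\kappa_-<\kappa_+$ are real numbers, $\mu$ is a fixed probability measure on $[\kappa_-,\kappa_+]$ with $\kappa_-,\kappa_+\in\mathrm{supp}(\mu)$, and $\Lambda(\lambda)=\log\int e^{\lambda z}\,d\mu(z)$ for $\lambda\in\mathbb R$. For each $N$, $A=A^{(N)}=(A_{ijk})_{i,j,k\in[N]}$ is a 3-tensor with nonnegative entries, invariant under permutations of its indices, with $A_{ijk}=0$ unless $i,j,k$ are all distinct. $A_i=(A_{ijk})_{j,k\in[N]}$ is the $i$-th matrix slice. For $\beta,h\in\mathbb R$, $P_{\beta,h}$ is the probability measure on $[\kappa_-,\kappa_+]^N$ with density $$\frac{dP_{\beta,h}}{d\mu^{\otimes N}}(x)=\frac{e^{f(x)}}{Z_N(\beta,h)},\qquad f(x)=\frac{\beta}{3}\sum_{i,j,k}A_{ijk}x_ix_jx_k+h\sum_i x_i,$$ where $Z_N(\beta,h)=\int e^{f}\,d\mu^{\otimes N}$. Put $m_i(x)=\sum_{j,k}A_{ijk}x_jx_k$ and $b(x)=(b_1(x),\dots,b_N(x))$ with $b_i(x)=\Lambda'(\beta m_i(x)+h)$ (the conditional mean of the $i$-th coordinate given the others under $P_{\beta,h}$). Rate function: for $t\in\mathbb R$, $I(t)=\sup_{\lambda\in\mathbb R}(\lambda t-\Lambda(\lambda))\in[0,\infty]$ (which is $+\infty$ for $t\notin[\kappa_-,\kappa_+]$); for a vector $t$, $I(t)=\sum_iI(t_i)$. All asymptotics are as $N\to\infty$. *)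

(* Defs.v *)
From HB Require Import structures.
From mathcomp Require Import all_boot all_order all_algebra.
From mathcomp Require Import finmap.
From mathcomp Require Import all_classical all_reals all_analysis.
Set Implicit Arguments.
Unset Strict Implicit.
Unset Printing Implicit Defensive.
Import Order.TTheory GRing.Theory Num.Theory.
Import numFieldNormedType.Exports.
Local Open Scope classical_set_scope.
Local Open Scope ring_scope.

Section tuple_power.
Context d (T : measurableType d) (R : realType) (mu : probability T R).

Definition tuple_cons n (x : T * n.-tuple T) : n.+1.-tuple T :=
  [the n.+1.-tuple T of x.1 :: x.2].

Lemma measurable_tuple_cons n : measurable_fun [set: _] (@tuple_cons n).
Proof. exact: measurable_cons. Qed.

HB.instance Definition _ n :=
  isMeasurableFun.Build _ _ _ _ (@tuple_cons n) (@measurable_tuple_cons n).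

(* The n-fold product measure of mu on n.-tuple T, equipped with the
   sigma-algebra generated by the coordinates. *)
Fixpoint tuple_power n : probability (n.-tuple T) R :=
  if n is n'.+1 then
    distribution (mu \x tuple_power n')%E
      (@tuple_cons n' : {mfun (T * n'.-tuple T)%type >-> n'.+1.-tuple T})
  else dirac ([tuple] : 0.-tuple T).

End tuple_power.

Section measure_on_line.
Context (R : realType) (mu : probability (measurableTypeR R) R).

Definition msupport : set R :=
  [set x | forall U : set R, open U -> U x -> (0 < mu U)%E].

Definition cumulant (l : R) : R := ln (\int[mu]_z expR (l * z)).

Definition rate (t : R) : \bar R :=
  ereal_sup [set (l * t - cumulant l)%:E | l in [set: R]].

Definition rate_tuple N (t : N.-tuple R) : \bar R :=
  (\sum_(i < N) rate (tnth t i))%E.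

End measure_on_line.

Section euclidean.
Context (R : realType).

(* The norm that MathComp-Analysis puts on matrices is the sup norm; the
   Euclidean norm and the operator norm it induces are defined here. *)
Definition l2norm N (v : 'cV[R]_N) : R := Num.sqrt (\sum_(i < N) v i 0 ^+ 2).

Definition opnorm N (M : 'M[R]_N) : R :=
  sup [set l2norm (M *m v) | v in [set v | l2norm v <= 1]].

Definition l2net N (S : set 'cV[R]_N) (e : R) (D : {fset 'cV[R]_N}) : Prop :=
  [set` D] `<=` S /\
  forall v, S v -> exists2 w, w \in D & l2norm (v - w) <= e.

End euclidean.

Section tensor.
Context (R : realType) (N : nat).
Implicit Types (A : 'I_N -> 'I_N -> 'I_N -> R) (x : N.-tuple R) (i : 'I_N).

Record interaction_tensor A : Prop := InteractionTensor {
  tensor_ge0 : forall i j k, 0 <= A i j k;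
  tensor_sym : forall i j k,
    [/\ A i k j = A i j k, A j i k = A i j k, A j k i = A i j k,
        A k i j = A i j k & A k j i = A i j k];
  tensor_diag : forall i j k, ~~ [&& i != j, j != k & i != k] -> A i j k = 0
}.

Definition slice A i : 'M[R]_N := \matrix_(j, k) A i j k.

Definition box (a b : R) : set (N.-tuple R) :=
  [set x | forall i, a <= tnth x i <= b].

Definition hamiltonian A (beta h : R) x : R :=
  beta / 3 * (\sum_(i < N) \sum_(j < N) \sum_(k < N)
                A i j k * tnth x i * tnth x j * tnth x k)
  + h * \sum_(i < N) tnth x i.

Definition local_field A x i : R :=
  \sum_(j < N) \sum_(k < N) A i j k * tnth x j * tnth x k.

Context (mu : probability (measurableTypeR R) R).

Definition partition_function A (beta h : R) : R :=
  \int[tuple_power mu N]_x expR (hamiltonian A beta h x).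

Definition cond_mean A (beta h : R) x : 'cV[R]_N :=
  \col_i derive1 (cumulant mu) (beta * local_field A x i + h).

Definition mean_field_sup A (beta h a b : R) : \bar R :=
  ereal_sup [set (hamiltonian A beta h t)%:E - rate_tuple mu t
            | t in box a b]%E.

End tensor.

(* Main.v *)
(** Write [S(A) = sum_ij (sum_k A_ijk)^2]. Testing [sum_i A_i^2] on the constant
    vector gives [S(A) <= N ||sum_i A_i^2||_op], so [S(A) = o(N)].

    Low complexity: round [z] to a finite grid, keep each coordinate with
    probability [1/q] and multiply the kept ones by [q]. In mean square this moves
    the vector [sum_jk A_ijk z_j w_k] by at most a constant (depending on [q]) times
    [S(A)], which is [o(N)], and the sparse grid vectors number only [exp(eta N)]
    with [eta -> 0] as [q] grows. This gives an l2-net [d] of the local fields,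
    and (ii) follows since [Lambda'] is Lipschitz on bounded sets.

    Upper bound in (i): a greedy (Frieze-Kannan) argument covers the box by
    [exp(o(N))] cells, each defined by finitely many conditions
    [|<x - y, d>| <= delta N]. By trilinearity [f] varies by [O(delta N)] on a cell
    [C], centroid included; and Jensen gives [mu^N(C) <= exp(-I(t))] for the
    centroid [t] of [mu^N] on [C]. Hence [C] contributes at most
    [exp(f(t) - I(t) + O(delta N))] to [Z_N].

    Lower bound in (i): [f] is affine in each coordinate and
    [Lambda(c) >= c t_i - I(t_i)], so integrating out one coordinate at a time
    yields [Z_N >= exp(f(t) - I(t))] for every [t]. *)
Require Import Defs.
From mathcomp Require Import all_boot all_order all_algebra.
From mathcomp Require Import finmap.
From mathcomp Require Import all_classical all_reals all_analysis.
From mathcomp Require Import ring lra zify.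
Import Order.TTheory GRing.Theory Num.Theory.
Import numFieldNormedType.Exports measurable_realfun.
Local Open Scope classical_set_scope.
Local Open Scope ring_scope.
Set Implicit Arguments.
Unset Strict Implicit.
Unset Printing Implicit Defensive.

(** * Sparsification *)

(* The right-hand side is the mean of the left-hand side over independent
   Bernoulli(1/q) variables [xi j]; the choices are made one at a time so that
   the conditional mean never increases. *)
Lemma sparsify (R : realFieldType) (n m q : nat) (c : R) (v : 'I_n -> 'I_m -> R) :
  (0 < q)%N -> exists xi : 'I_n -> bool,
  \sum_i (\sum_j (1 - q%:R * (xi j)%:R) * v j i) ^+ 2 + c * (\sum_j xi j)%N%:R
   <= (q%:R - 1) * \sum_j \sum_i v j i ^+ 2 + c * (n%:R / q%:R).
Proof.
move=> q0; elim: n v => [|n IH] v.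
  exists (fun=> true); rewrite !big_ord0 !mul0r !mulr0 !addr0.
  by rewrite big1 // => i _; rewrite big_ord0 expr0n.
have [xi hxi] := IH (fun j => v (widen_ord (leqnSn n) j)).
pose s i := \sum_j (1 - q%:R * (xi j)%:R) * v (widen_ord (leqnSn n) j) i.
pose w := v ord_max.
pose xi' b (j : 'I_n.+1) := if unlift ord_max j is Some j' then xi j' else b.
have widE j : widen_ord (leqnSn n) j = lift ord_max j.
  by apply: val_inj; rewrite /= /bump leqNgt ltn_ord.
have xiw b j : xi' b (widen_ord (leqnSn n) j) = xi j.
  by rewrite /xi' widE liftK.
have xim b : xi' b ord_max = b by rewrite /xi' unlift_none.
have step b : \sum_i (\sum_j (1 - q%:R * (xi' b j)%:R) * v j i) ^+ 2 +
    c * (\sum_j xi' b j)%N%:R = \sum_i s i ^+ 2 + c * (\sum_j xi j)%N%:R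
    + 2 * (1 - q%:R * b%:R) * (\sum_i s i * w i)
    + (1 - q%:R * b%:R) ^+ 2 * (\sum_i w i ^+ 2) + c * b%:R.
  have -> : (\sum_j xi' b j = \sum_j xi j + b)%N.
    by rewrite big_ord_recr /= xim; congr (_ + _)%N; apply: eq_bigr => j _; rewrite xiw.
  rewrite (eq_bigr (fun i => s i ^+ 2 + 2 * (1 - q%:R * b%:R) * (s i * w i)
       + (1 - q%:R * b%:R) ^+ 2 * w i ^+ 2)); last first.
    move=> i _; rewrite big_ord_recr /= xim; under eq_bigr do rewrite xiw.
    by rewrite -/(s i) -/(w i); ring.
  by rewrite !big_split /= -!mulr_sumr natrD; ring.
have {}hxi : \sum_i s i ^+ 2 + c * (\sum_j xi j)%N%:R <=
  (q%:R - 1) * (\sum_(j < n) \sum_i v (widen_ord (leqnSn n) j) i ^+ 2)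
   + c * (n%:R / q%:R) by [].
rewrite [\sum_(j < n.+1) _]big_ord_recr /=.
have := step false; have := step true.
move: hxi; set a := \sum_i s i ^+ 2 + _; set e := \sum_i w i ^+ 2.
set d := \sum_i s i * w i; set S := \sum_(j < n) _ => hxi ht hf.
have q1 : (1 : R) <= q%:R by rewrite ler1n.
have qi : (q%:R : R) * q%:R^-1 = 1 by rewrite mulfV // gt_eqF // ltr0n.
have qi0 : (0 : R) < q%:R^-1 by rewrite invr_gt0 ltr0n.
set i := (q%:R^-1 : R) in qi qi0 hxi *; set Q := (q%:R : R) in q1 qi hxi ht hf *.
rewrite (_ : c * (n.+1%:R * i) = c * (n%:R * i) + c * i); last by rewrite -natr1; ring.
case: (lerP (a + 2 * (1 - Q * true%:R) * d + (1 - Q * true%:R) ^+ 2 * e + c * true%:R)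
   (a + (Q - 1) * e + c * i)) => h1.
  by exists (xi' true); rewrite ht; move: h1 hxi; rewrite -/e; lra.
case: (lerP (a + 2 * (1 - Q * false%:R) * d + (1 - Q * false%:R) ^+ 2 * e + c * false%:R)
   (a + (Q - 1) * e + c * i)) => h2.
  by exists (xi' false); rewrite hf; move: h2 hxi; rewrite -/e; lra.
(* Both choices exceed the target. Weighting [true] by [1/q] and [false] by [1 - 1/q] gives
   [1 - q b] mean [0] and second moment [q - 1], so the weighted mean of the two choices equals the
   target, a contradiction. *)
exfalso.
have : (Q - 1) * (a + (Q - 1) * e + c * i) <=
    (Q - 1) * (a + 2 * (1 - Q * false%:R) * d + (1 - Q * false%:R) ^+ 2 * e + c * false%:R).
  by rewrite ler_wpM2l ?(ltW h2) // subr_ge0.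
rewrite /= in h1 *; rewrite !mulr0 !subr0.
have -> : (Q - 1) * (a + (Q - 1) * e + c * i) = (Q - 1) * (a + (Q - 1) * e) + c * (Q * i) - c * i by ring.
rewrite qi; move: h1; rewrite !mulr1; lra.
Qed.

Lemma card_sparse (N r s T : nat) :
  (0 < T)%N ->
  (#|[set phi : {ffun 'I_N -> option 'I_r} | (\sum_i (phi i : bool) <= s)%N]%SET|
    * T ^ (N - s) <= (T + r) ^ N)%N.
Proof.
(* With weight [T] on [None] and [1] on [Some _], all maps have total weight
   [(T + r) ^ N] and a sparse map has weight at least [T ^ (N - s)]. *)
move=> T0; pose wt (o : option 'I_r) := if o is Some _ then 1%N else T.
have -> : ((T + r) ^ N = \sum_(phi : {ffun 'I_N -> option 'I_r}) \prod_i wt (phi i))%N.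
  rewrite -(bigA_distr_bigA (fun _ o => wt o)) /= prod_nat_const card_ord; congr (_ ^ _)%N.
  rewrite (bigD1 None) //=; congr (_ + _)%N.
  rewrite (eq_bigr (fun=> 1%N)); last by case.
  rewrite sum1_card; have := cardC1 (None : option 'I_r).
  by rewrite card_option card_ord /= => e; rewrite -[LHS]e; apply: eq_card.
rewrite -sum_nat_const [leqRHS](bigID (mem
  [set phi : {ffun 'I_N -> option 'I_r} | (\sum_i (phi i : bool) <= s)%N]%SET)) /=.
apply: leq_trans (leq_addr _ _); apply: leq_sum => phi; rewrite inE => hs.
have -> : (\prod_i wt (phi i) = T ^ (N - \sum_i (phi i : bool)))%N.
  have <- : (\sum_i (~~ phi i) = N - \sum_i (phi i : bool))%N.
    have e : (\sum_(i < N) 1 = N)%N by rewrite sum1_card card_ord.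
    rewrite -[X in (X - _)%N]e -sumnB; last by move=> i _; case: (phi i).
    by apply: eq_bigr => i _; case: (phi i).
  rewrite expn_sum; apply: eq_bigr => i _; rewrite /wt.
  by case: (phi i) => //=; rewrite expn1.
exact/leq_pexp2l/leq_sub2l.
Qed.

(** * Bilinear local fields and their finite nets *)

(* [bil A x x i] is the local field m_i(x). *)
Definition bil (R : realType) N (A : 'I_N -> 'I_N -> 'I_N -> R) (z w : 'I_N -> R) i :=
  \sum_j \sum_k A i j k * z j * w k.

Definition sqn (R : realType) N (u : 'I_N -> R) := \sum_i u i ^+ 2.

(** The quantity [S(A)]; the estimates below see the mean-field condition through it. *)
Definition degree_sq (R : realType) N (A : 'I_N -> 'I_N -> 'I_N -> R) :=
  \sum_i \sum_j (\sum_k A i j k) ^+ 2.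

Section bilinear.
Context (R : realType) (N : nat) (A : 'I_N -> 'I_N -> 'I_N -> R).
Hypothesis hA : interaction_tensor A.
Implicit Types z w u : 'I_N -> R.

Let A0 := tensor_ge0 hA.

Lemma tensor_swap i j k : A i k j = A i j k.
Proof. by case: (tensor_sym hA i j k). Qed.

Lemma bilC z w i : bil A z w i = bil A w z i.
Proof.
rewrite /bil exchange_big /=; apply: eq_bigr => j _; apply: eq_bigr => k _.
by rewrite tensor_swap mulrAC.
Qed.

Lemma bilBr z w u i : bil A z (fun j => w j - u j) i = bil A z w i - bil A z u i.
Proof.
rewrite /bil -sumrB; apply: eq_bigr => j _; rewrite -sumrB.
by apply: eq_bigr => k _; rewrite mulrBr.
Qed.

Lemma bilBl z w u i : bil A (fun j => z j - u j) w i = bil A z w i - bil A u w i.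
Proof. by rewrite bilC bilBr bilC [bil A w u i]bilC. Qed.

Lemma bil_bound gam a b z w i : 0 <= a -> 0 <= b ->
  \sum_j \sum_k A i j k <= gam ->
  (forall j, `|z j| <= a) -> (forall j, `|w j| <= b) ->
  `|bil A z w i| <= a * b * gam.
Proof.
move=> a0 b0 hg hz hw.
apply: (@le_trans _ _ (a * b * \sum_j \sum_k A i j k)); last first.
  by rewrite ler_wpM2l // mulr_ge0.
rewrite mulr_sumr; apply: (le_trans (ler_norm_sum _ _ _)); apply: ler_sum => j _.
rewrite mulr_sumr; apply: (le_trans (ler_norm_sum _ _ _)); apply: ler_sum => k _.
rewrite !normrM (ger0_norm (A0 i j k)) -mulrA mulrC.
by rewrite ler_wpM2r // ler_pM.
Qed.

Lemma sqn_ge0 u : 0 <= sqn u.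
Proof. by apply: sumr_ge0 => i _; rewrite sqr_ge0. Qed.

Lemma degree_sq_ge0 : 0 <= degree_sq A.
Proof. by apply: sumr_ge0 => i _; apply: sumr_ge0 => j _; rewrite sqr_ge0. Qed.

Lemma sqn_bound a u : (forall i, `|u i| <= a) -> sqn u <= a ^+ 2 * N%:R.
Proof.
move=> hu; apply: (@le_trans _ _ (\sum_(i < N) a ^+ 2)).
  by apply: ler_sum => i _; rewrite -real_normK ?num_real // lerXn2r ?nnegrE // (le_trans _ (hu i)).
by rewrite sumr_const card_ord mulr_natr.
Qed.

(** [sparsify] is applied to the vectors indexed by [k] whose [i]-th entry is [w_k sum_j A_ijk z_j].
    In absolute value such an entry is at most [a b sum_j A_ijk], so the squared norms add up to at
    most [a^2 b^2 degree_sq A]. *)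
Lemma sparsify_bil q c a b z w : (0 < q)%N -> 0 <= a -> 0 <= b ->
  (forall j, `|z j| <= a) -> (forall j, `|w j| <= b) ->
  exists xi : 'I_N -> bool,
    sqn (bil A z (fun k => w k - q%:R * (xi k)%:R * w k)) + c * (\sum_k xi k)%N%:R
    <= (q%:R - 1) * (a ^+ 2 * b ^+ 2 * degree_sq A) + c * (N%:R / q%:R).
Proof.
move=> q0 a0 b0 hz hw.
have [xi hxi] := @sparsify R N N q c (fun k i => \sum_j A i j k * z j * w k) q0.
exists xi; apply: le_trans (le_trans hxi _).
  rewrite lerD2r; apply: ler_sum => i _; rewrite le_eqVlt; apply/orP; left.
  rewrite /bil exchange_big /=; apply/eqP; congr (_ ^+ 2); apply: eq_bigr => k _.
  by rewrite mulr_sumr; apply: eq_bigr => j _; ring.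
rewrite lerD2r ler_wpM2l //; first by rewrite subr_ge0 ler1n.
rewrite /degree_sq exchange_big /= mulr_sumr; apply: ler_sum => i _.
rewrite mulr_sumr; apply: ler_sum => k _.
rewrite -!exprMn -real_normK ?num_real // lerXn2r ?nnegrE //.
  by rewrite !mulr_ge0 // sumr_ge0.
rewrite mulr_sumr; apply: (le_trans (ler_norm_sum _ _ _)); apply: ler_sum => j _.
rewrite !normrM (ger0_norm (A0 i j k)) -mulrA mulrC tensor_swap.
by rewrite ler_wpM2r // ler_pM.
Qed.

End bilinear.

Lemma grid_round (R : realType) (K : R) (r : nat) (z : R) : 0 < K -> (0 < r)%N ->
  `|z| <= K -> exists a : 'I_r.+1,
   `|- K + 2 * K * (a%:R / r%:R)| <= K /\
   `|z - (- K + 2 * K * (a%:R / r%:R))| <= 2 * K / r%:R.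
Proof.
move=> K0 r0 /ler_normlP[h1 h2].
have r0' : (0 : R) < r%:R by rewrite ltr0n.
pose y := (z + K) * r%:R / (2 * K).
have y0 : 0 <= y by rewrite /y divr_ge0 ?mulr_ge0 //; lra.
have hy := truncn_itv y0.
have yr : y <= r%:R.
  by rewrite /y ler_pdivrMr; [rewrite mulrC ler_wpM2l//|]; lra.
have ar : (Num.truncn y < r.+1)%N.
  by rewrite ltnS -(ler_nat R); case/andP: hy => h _; lra.
exists (Ordinal ar) => /=.
have ez : z = - K + 2 * K * (y / r%:R).
  by rewrite /y; field; lra.
set a := (Num.truncn y)%:R in hy *.
have a0 : (0 : R) <= a by rewrite /a.
have har : a <= r%:R by rewrite /a ler_nat -ltnS.
have b0 : 0 <= a / r%:R by rewrite divr_ge0 // ltW.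
have b1 : a / r%:R <= 1 by rewrite ler_pdivrMr // mul1r.
split; first by apply/ler_normlP; split; nra.
rewrite {1}ez (_ : _ - _ = 2 * K / r%:R * (y - a)); last by field; lra.
have c0 : 0 < 2 * K / r%:R by rewrite divr_gt0 // mulr_gt0.
rewrite normrM (gtr0_norm c0) -[leRHS]mulr1 ler_pM2l //.
case/andP: hy => h3; rewrite -natr1 -/a => h4.
by apply/ler_normlP; split; lra.
Qed.

Lemma sqr_sum3 (R : realFieldType) (a b c : R) :
  (a + b + c) ^+ 2 <= 3 * (a ^+ 2 + b ^+ 2 + c ^+ 2).
Proof.
rewrite -subr_ge0 (_ : _ - _ = (a - b) ^+ 2 + (b - c) ^+ 2 + (a - c) ^+ 2).
  by rewrite !addr_ge0 ?sqr_ge0.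
by ring.
Qed.

(** Take logarithms in [card_sparse] with cutoff [2N/q] and use [ln(T + r) <= ln T + r/T]. The
    weight [T] stays free, so the rate can be made small by taking first [T] large, then [q]. *)
Lemma ln_card_sparse (R : realType) (N r q T : nat) : (0 < q)%N -> (0 < T)%N ->
  ln #|[set phi : {ffun 'I_N -> option 'I_r} |
         (\sum_i (phi i : bool) <= 2 * N %/ q)%N]%SET|%:R
  <= N%:R * (2 * ln T%:R / q%:R + r%:R / T%:R) :> R.
Proof.
move=> q0 T0; set X := [set phi | _]%SET.
have X0 : (0 < #|X|)%N.
  apply/card_gt0P; exists [ffun=> None]; rewrite inE big1 // => i _.
  by rewrite ffunE.
have := @card_sparse N r (2 * N %/ q) T T0; rewrite -/X.
set s := (2 * N %/ q)%N => h.
have hs : s%:R <= 2 * N%:R / q%:R :> R.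
  rewrite ler_pdivlMr ?ltr0n // -!natrM ler_nat.
  by have := leq_trunc_div (2 * N) q; rewrite -/s.
have T1 : (1 : R) <= T%:R by rewrite ler1n.
have lnT : 0 <= ln T%:R :> R by rewrite ln_ge0.
have : ln (#|X| * T ^ (N - s))%:R <= ln ((T + r) ^ N)%:R :> R.
  by rewrite ler_ln ?posrE ?ltr0n ?muln_gt0 ?X0 ?expn_gt0 ?addn_gt0 ?T0 // ler_nat.
rewrite natrM !natrX lnM ?posrE ?ltr0n ?exprn_gt0 ?ltr0n //.
rewrite !lnXn ?ltr0n ?addn_gt0 ?T0 // -!(mulr_natl (ln _)).
have e : ln (T + r)%:R <= ln T%:R + r%:R / T%:R :> R.
  have -> : (T + r)%:R = T%:R * (1 + r%:R / T%:R) :> R.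
    by rewrite natrD; field; lra.
  have c0 : 0 <= r%:R / T%:R :> R by rewrite divr_ge0.
  have c1 : 0 < 1 + r%:R / T%:R :> R by lra.
  rewrite (lnM (x := T%:R)) ?posrE ?ltr0n // lerD2l le_ln1Dx //; lra.
have hN : N%:R - s%:R <= (N - s)%:R :> R.
  by rewrite lerBlDr -natrD ler_nat; lia.
have N0 : (0 : R) <= N%:R by [].
move=> h1.
have h2 := ler_wpM2r lnT hN.
have h3 := ler_wpM2l N0 e.
have h4 := ler_wpM2r lnT hs.
rewrite mulrDr; rewrite mulrDr in h3; rewrite mulrBl in h2.
have -> : N%:R * (2 * ln T%:R / q%:R) = 2 * N%:R / q%:R * ln T%:R :> R by ring.
by lra.
Qed.

Lemma sqn_sum3 (R : realType) N (u v w : 'I_N -> R) :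
  sqn (fun i => u i + v i + w i) <= 3 * (sqn u + sqn v + sqn w).
Proof.
rewrite /sqn -!big_split /= mulr_sumr; apply: ler_sum => i _; exact: sqr_sum3.
Qed.

(** The net consists of the values of [bil A] on pairs of sparse grid vectors. Both arguments are
    rounded to the grid, then sparsified one after the other, each against the current value of the
    other one. *)
Lemma bil_net (R : realType) N (A : 'I_N -> 'I_N -> 'I_N -> R)
    (K gam delta : R) (q r : nat) :
  interaction_tensor A -> 0 < K -> 0 < delta -> (0 < q)%N -> (0 < r)%N ->
  (forall i, \sum_j \sum_k A i j k <= gam) ->
  (4 * K ^+ 2 * gam / r%:R) ^+ 2 <= delta ->
  (q%:R - 1) * (q%:R ^+ 2 * K ^+ 4 * degree_sq A) <= delta * (N%:R / q%:R) ->
  exists (I : finType) (d : I -> 'I_N -> R),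
   (forall T : nat, (0 < T)%N ->
     ln #|I|%:R <= N%:R * (4 * ln T%:R / q%:R + 2 * r.+1%:R / T%:R) :> R) /\
   forall z w, (forall j, `|z j| <= K) -> (forall j, `|w j| <= K) ->
   exists p, sqn (fun i => bil A z w i - d p i) <= 15 * delta * N%:R.
Proof.
move=> hA K0 de0 q0 r0 hgam hr hS.
(* [Some a] marks a kept coordinate with grid value [a]. The cutoff is twice the expected number
   [N/q] of kept coordinates. *)
pose X : finType := {phi : {ffun 'I_N -> option 'I_r.+1} |
            (\sum_i (phi i : bool) <= 2 * N %/ q)%N}.
pose g (a : 'I_r.+1) : R := - K + 2 * K * (a%:R / r%:R).
pose vec (phi : X) j : R := if val phi j is Some a then q%:R * g a else 0.
pose I : finType := (X * X)%type.
exists I, (fun p => bil A (vec p.1) (vec p.2)); split.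
  move=> T T0; have := @ln_card_sparse R N r.+1 q T q0 T0.
  rewrite cardsE -card_sig card_prod -/X natrM => h.
  have [X0|X0] := posnP #|X|.
    rewrite X0 mulr0 ln0 // mulr_ge0 // addr_ge0 ?divr_ge0 ?mulr_ge0 //.
    by rewrite ln_ge0 // ler1n.
  by rewrite lnM ?posrE ?ltr0n //; lra.
move=> z w hz hw.
pose round (u : 'I_N -> R) (hu : forall j, `|u j| <= K) j :=
  projT1 (cid (grid_round K0 r0 (hu j))).
have roundP u (hu : forall j, `|u j| <= K) j :
    `|g (round u hu j)| <= K /\ `|u j - g (round u hu j)| <= 2 * K / r%:R.
  by rewrite /round; case: cid => a [].
set az := round z hz; set aw := round w hw.
pose z1 j := g (az j); pose w1 j := g (aw j).
have hz1 j : `|z1 j| <= K by case: (roundP z hz j).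
have hw1 j : `|w1 j| <= K by case: (roundP w hw j).
have ez j : `|z j - z1 j| <= 2 * K / r%:R by case: (roundP z hz j).
have ew j : `|w j - w1 j| <= 2 * K / r%:R by case: (roundP w hw j).
have K0' := ltW K0; have q1 : (1 : R) <= q%:R by rewrite ler1n.
have [xi hxi] := sparsify_bil hA delta q0 K0' K0' hz1 hw1.
pose w2 k := q%:R * (xi k)%:R * w1 k.
have hw2 j : `|w2 j| <= q%:R * K.
  rewrite /w2 normrM ler_pM // normrM; case: (xi j).
    by rewrite normr1 mulr1 ger0_norm // (le_trans _ q1).
  by rewrite normr0 mulr0.
have qK0 : 0 <= q%:R * K by rewrite mulr_ge0.
(* The second round works against [w2], whose entries can be as large as [q K]; hence the factor
   [q^2] in the hypothesis on [degree_sq A]. *)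
have [xi' hxi'] := sparsify_bil hA delta q0 qK0 K0' hw2 hz1.
pose z2 k := q%:R * (xi' k)%:R * z1 k.
have S0 := degree_sq_ge0 A.
have qi0 : 0 <= q%:R^-1 :> R by rewrite invr_ge0.
have D0 : 0 <= (q%:R - 1) * (K ^+ 4 * degree_sq A).
  by rewrite !mulr_ge0 ?subr_ge0 ?exprn_ge0.
have hS1 : (q%:R - 1) * (K ^+ 2 * K ^+ 2 * degree_sq A) <= delta * (N%:R / q%:R).
  apply: le_trans hS; rewrite -exprD.
  have -> : (q%:R - 1) * (q%:R ^+ 2 * K ^+ 4 * degree_sq A) =
    q%:R ^+ 2 * ((q%:R - 1) * (K ^+ 4 * degree_sq A)) by ring.
  by rewrite ler_peMl // expr_ge1 // (le_trans _ q1).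
have hS2 : (q%:R - 1) * ((q%:R * K) ^+ 2 * K ^+ 2 * degree_sq A) <= delta * (N%:R / q%:R).
  by apply: le_trans hS; rewrite exprMn -[_ * K ^+ 2 * K ^+ 2]mulrA -exprD.
have hNq : delta * (N%:R / q%:R) <= delta * N%:R.
  by rewrite ler_pM2l // ler_pdivrMr ?ltr0n // ler_peMr.
(* With penalty weight [delta], the sparsification bound is at most [2 delta N/q]. The error term is
   nonnegative, so at most [2N/q] coordinates are kept. *)
have cnt (x : 'I_N -> bool) (y : R) : 0 <= y ->
    y + delta * (\sum_k x k)%N%:R <= delta * (N%:R / q%:R) + delta * (N%:R / q%:R) ->
    (\sum_k x k <= 2 * N %/ q)%N.
  move=> y0 hy; rewrite leq_divRL // -(ler_nat R) !natrM -ler_pdivlMr ?ltr0n //.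
  rewrite -(ler_pM2l de0); apply: le_trans (le_trans hy _).
    by rewrite lerDr.
  by rewrite -mulrA; lra.
have mkX (x : 'I_N -> bool) (a : 'I_N -> 'I_r.+1) : (\sum_k x k <= 2 * N %/ q)%N ->
    exists phi : X, vec phi =1 (fun k => q%:R * (x k)%:R * g (a k)).
  move=> hx; pose f := [ffun k => if x k then Some (a k) else None].
  have hf : (\sum_i (f i : bool) <= 2 * N %/ q)%N.
    by apply: leq_trans hx; apply: leq_sum => i _; rewrite ffunE; case: (x i).
  exists (exist _ f hf) => k; rewrite /vec /= ffunE.
  by case: (x k); rewrite ?mulr1 // mulr0 mul0r.
have [pz hpz] : exists phi : X, vec phi =1 z2.
  by apply: mkX; apply: (cnt _ _ (sqn_ge0 _)); apply: (le_trans hxi'); rewrite lerD2r.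
have [pw hpw] : exists phi : X, vec phi =1 w2.
  by apply: mkX; apply: (cnt _ _ (sqn_ge0 _)); apply: (le_trans hxi); rewrite lerD2r.
exists (pz, pw) => /=.
have {hpz}-> : vec pz = z2 by apply/funext.
have {hpw}-> : vec pw = w2 by apply/funext.
have hle (x : 'I_N -> bool) (y e : R) : e <= delta * (N%:R / q%:R) ->
    y + delta * (\sum_k x k)%N%:R <= e + delta * (N%:R / q%:R) ->
    y <= 2 * delta * N%:R.
  move=> he hy; have : 0 <= delta * (\sum_k x k)%N%:R by rewrite mulr_ge0 // ltW.
  by lra.
have := hle _ _ _ hS2 hxi'; have := hle _ _ _ hS1 hxi.
set u2 := fun i : 'I_N => _ => hu2; set u3 := fun i : 'I_N => _ => hu3.
(* The path from [(z, w)] through [(z1, w1)] and [(z1, w2)] to [(z2, w2)] has squared costs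
   [delta N], [2 delta N] and [2 delta N]; with the factor 3 of [sqn_sum3] they give
   [15 delta N]. *)
pose v2 := bil A z1 u2; pose v3 := bil A w2 u3.
pose u1 i := bil A z w i - bil A z1 w1 i.
have hu1 : sqn u1 <= delta * N%:R.
  apply: le_trans (_ : _ <= (4 * K ^+ 2 * gam / r%:R) ^+ 2 * N%:R) _; last first.
    by rewrite ler_wpM2r.
  apply: sqn_bound => i; rewrite /u1.
  have -> : bil A z w i - bil A z1 w1 i = bil A z (fun j => w j - w1 j) i
       + bil A (fun j => z j - z1 j) w1 i by rewrite bilBr bilBl //; ring.
  have r0' : 0 <= 2 * K / r%:R by rewrite divr_ge0 // mulr_ge0.
  apply: (le_trans (ler_normD _ _)).
  have := bil_bound hA K0' r0' (hgam i) hz ew.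
  have := bil_bound hA r0' K0' (hgam i) ez hw1.
  have -> : 4 * K ^+ 2 * gam / r%:R = 2 * K / r%:R * K * gam + K * (2 * K / r%:R) * gam by ring.
  by lra.
apply: le_trans (_ : _ <= 3 * (sqn u1 + sqn v2 + sqn v3)) _; last first.
  by move: hu1 hu2 hu3; rewrite -/v2 -/v3; lra.
apply: le_trans (sqn_sum3 _ _ _); rewrite le_eqVlt; apply/orP; left; apply/eqP.
rewrite /sqn; apply: eq_bigr => i _; congr (_ ^+ 2).
by rewrite /u1 /v2 /v3 /u2 /u3 !bilBr ![bil A _ z1 i]bilC // [bil A w2 z2 i]bilC //; ring.
Qed.

Lemma ln_nat_ge0 (R : realType) n : 0 <= ln n%:R :> R.
Proof. by case: n => [|n]; [rewrite ln0 | rewrite ln_ge0 // ler1n]. Qed.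

Lemma grid_size (R : realType) (K gam delta : R) : 0 < delta ->
  exists2 r : nat, (0 < r)%N & (4 * K ^+ 2 * gam / r%:R) ^+ 2 <= delta.
Proof.
move=> d0; pose r := (Num.truncn ((4 * K ^+ 2 * gam) ^+ 2 / delta)).+1.
exists r => //.
have h : (4 * K ^+ 2 * gam) ^+ 2 / delta <= r%:R.
  by rewrite ltW // truncnS_gt.
have r1 : (1 : R) <= r%:R by rewrite ler1n.
rewrite expr_div_n ler_pdivrMr; last by rewrite exprn_gt0 // (lt_le_trans _ r1).
rewrite ler_pdivrMr // in h; apply: (le_trans h).
by rewrite mulrC ler_pM2l // expr2 ler_peMr // (le_trans _ r1).
Qed.

(** With [q = 1] the factor [q - 1] makes the smallness hypothesis of [bil_net] trivial. This
    provides some finite net for every [N], with no control of its size. *)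
Lemma finite_net (R : realType) (K gam delta : R) N
    (A : 'I_N -> 'I_N -> 'I_N -> R) : 0 < K -> 0 < delta ->
  interaction_tensor A -> (forall i, \sum_j \sum_k A i j k <= gam) ->
  exists (I : finType) (d : I -> 'I_N -> R),
  forall z w, (forall j, `|z j| <= K) -> (forall j, `|w j| <= K) ->
  exists p, sqn (fun i => bil A z w i - d p i) <= delta * N%:R.
Proof.
move=> K0 d0 hA hg; have d15 : 0 < delta / 15 by rewrite divr_gt0.
have [r r0 hr] := grid_size K gam d15.
have [|I [d [_ hd]]] := bil_net hA K0 d15 (ltn0Sn 0) r0 hg hr.
  by rewrite subrr mul0r mulr_ge0 ?(ltW d15) ?divr_ge0.
exists I, d => z w hz hw; have [p hp] := hd z w hz hw; exists p.
by apply: (le_trans hp); lra.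
Qed.

(** The parameters are chosen in order: the grid [r] from [delta], then [T] so that
    [2(r+1)/T <= eta/2], then [q] so that [4 ln T/q <= eta/2], and last [eps], which depends on
    [q]. *)
Lemma low_complexity (R : realType) (K gam delta eta : R) :
  0 < K -> 0 < delta -> 0 < eta ->
  exists2 eps : R, 0 < eps & forall N (A : 'I_N -> 'I_N -> 'I_N -> R),
  interaction_tensor A -> (forall i, \sum_j \sum_k A i j k <= gam) ->
  degree_sq A <= eps * N%:R ->
  exists (I : finType) (d : I -> 'I_N -> R),
  ln #|I|%:R <= eta * N%:R /\
  forall z w, (forall j, `|z j| <= K) -> (forall j, `|w j| <= K) ->
  exists p, sqn (fun i => bil A z w i - d p i) <= delta * N%:R.
Proof.
move=> K0 d0 e0; have d15 : 0 < delta / 15 by rewrite divr_gt0.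
have [r r0 hr] := grid_size K gam d15.
pose T := (Num.truncn (4 * r.+1%:R / eta)).+1.
pose q := (Num.truncn (8 * ln T%:R / eta)).+1.
have hT : 2 * r.+1%:R / T%:R <= eta / 2.
  have : 4 * r.+1%:R / eta <= T%:R by rewrite ltW // truncnS_gt.
  by rewrite !ler_pdivrMr ?ltr0n //; lra.
have hq : 4 * ln T%:R / q%:R <= eta / 2.
  have : 8 * ln T%:R / eta <= q%:R by rewrite ltW // truncnS_gt.
  by rewrite !ler_pdivrMr ?ltr0n //; lra.
have q1 : (1 : R) <= q%:R by rewrite ler1n.
have q0 : (0 : R) < q%:R by rewrite ltr0n.
have c0 : 0 < q%:R ^+ 4 * K ^+ 4 by rewrite mulr_gt0 // exprn_gt0.
(* The hypothesis of [bil_net], multiplied by [q], follows from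
   [q^4 K^4 degree_sq A <= (delta/15) N]. *)
exists (delta / 15 / (q%:R ^+ 4 * K ^+ 4)); first by rewrite divr_gt0.
move=> N A hA hg; rewrite mulrAC ler_pdivlMr // => hS.
have S0 := degree_sq_ge0 A.
have [|I [d [hI hd]]] := bil_net hA K0 d15 (ltn0Sn _ : (0 < q)%N) r0 hg hr.
  rewrite [leRHS]mulrA ler_pdivlMr //; apply: le_trans hS.
  have -> : (q%:R - 1) * (q%:R ^+ 2 * K ^+ 4 * degree_sq A) * q%:R =
     (q%:R - 1) * (q%:R ^+ 3 * K ^+ 4 * degree_sq A) by ring.
  have -> : degree_sq A * (q%:R ^+ 4 * K ^+ 4) =
     q%:R * (q%:R ^+ 3 * K ^+ 4 * degree_sq A) by ring.
  by rewrite ler_wpM2r ?mulr_ge0 ?exprn_ge0 ?(ltW q0) ?(ltW K0) //; lra.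
exists I, d; split.
  apply: (le_trans (hI T (ltn0Sn _))); rewrite mulrC ler_wpM2r //; lra.
move=> z w hz hw; have [p hp] := hd z w hz hw; exists p.
by apply: (le_trans hp); lra.
Qed.

(** * Greedy decomposition of the box into cells *)

Definition dot (R : realType) N (u v : 'I_N -> R) := \sum_i u i * v i.

Section dot.
Context (R : realType) (N : nat).
Implicit Types u v w : 'I_N -> R.

Lemma dotBl u v w : dot (fun i => u i - v i) w = dot u w - dot v w.
Proof. by rewrite /dot -sumrB; apply: eq_bigr => i _; rewrite mulrBl. Qed.

Lemma dotBr u v w : dot w (fun i => u i - v i) = dot w u - dot w v.
Proof. by rewrite /dot -sumrB; apply: eq_bigr => i _; rewrite mulrBr. Qed.

(** Weighted AM-GM in each coordinate: [(a |u_i| - |v_i|)^2 / a >= 0]. *)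
Lemma dot_le a u v : 0 < a -> `|dot u v| <= (a * sqn u + sqn v / a) / 2.
Proof.
move=> a0; apply: (le_trans (ler_norm_sum _ _ _)).
rewrite /sqn mulr_sumr !mulr_suml -big_split /= mulr_suml; apply: ler_sum => i _.
have h : 0 <= (a * `|u i| - `|v i|) ^+ 2 / a by rewrite divr_ge0 ?sqr_ge0 // ltW.
have e : (a * `|u i| - `|v i|) ^+ 2 / a = a * u i ^+ 2 + v i ^+ 2 / a - 2 * `|u i * v i|.
  rewrite -[u i ^+ 2]real_normK ?num_real // -[v i ^+ 2]real_normK ?num_real // normrM.
  by field; lra.
by rewrite e in h; lra.
Qed.

Lemma sqn_subZ u v c :
  sqn (fun i => u i - c * v i) = sqn u - 2 * c * dot u v + c ^+ 2 * sqn v.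
Proof.
rewrite /sqn /dot !mulr_sumr -sumrB -big_split /=.
by apply: eq_bigr => i _; ring.
Qed.

End dot.

(* Correcting [y] by a multiple of a violated test vector lowers the squared
   distance to [x] by a fixed multiple of [N]. *)
Lemma greedy_step (R : realType) N (I : finType) (d : I -> 'I_N -> R)
    (G K delta : R) (k : nat) : 0 < G -> 0 < delta ->
  (forall p, sqn (d p) <= G * N%:R) ->
  exists (J : finType) (y : J -> 'I_N -> R),
  #|J| = ((2 * #|I|).+1 ^ k)%N /\
  forall x, (forall j, `|x j| <= K) -> exists e,
   (forall p, `|dot (fun i => x i - y e i) (d p)| <= delta * N%:R) \/
   sqn (fun i => x i - y e i) <= (K ^+ 2 - k%:R * (delta ^+ 2 / G)) * N%:R.
Proof.
move=> G0 d0 hd; elim: k => [|k [J [y [cJ hy]]]].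
  exists unit, (fun _ _ => 0); split; first by rewrite card_unit expn0.
  move=> x hx; exists tt; right; rewrite mul0r subr0.
  by apply: sqn_bound => i; rewrite subr0.
(* This step minimises [c^2 G - 2 c delta] and so gains [delta^2/G] in units of [N]. The move [None]
   keeps the centre when no test vector is violated, hence [2 #|I| + 1] moves per round. *)
pose c := delta / G.
pose sg (b : bool) : R := if b then c else - c.
pose st (o : option (bool * I)) i := if o is Some (b, p) then sg b * d p i else 0.
exists (J * option (bool * I))%type, (fun e i => y e.1 i + st e.2 i); split.
  by rewrite card_prod card_option card_prod card_bool cJ expnS mulnC.
move=> x hx; have [e he] := hy x hx.
have e0 o : (fun i => x i - (y e i + st o i)) = (fun i => (x i - y e i) - st o i).
  by apply/funext => i; ring.
have stN : (fun i => (x i - y e i) - st None i) = (fun i => x i - y e i).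
  by apply/funext => i; rewrite /= subr0.
case: (pselect (forall p, `|dot (fun i => x i - y e i) (d p)| <= delta * N%:R)) => [h|].
  by exists (e, None); left; rewrite e0 stN.
move=> /existsNP[p /negP]; rewrite -ltNge => hp.
have {he}he : sqn (fun i => x i - y e i) <= (K ^+ 2 - k%:R * (delta ^+ 2 / G)) * N%:R.
  case: he => // /(_ p); by rewrite leNgt hp.
set u := (fun i => x i - y e i) in hp he.
exists (e, Some (0 < dot u (d p), p)); right; rewrite e0 -/u.
have -> : (fun i => u i - st (Some (0 < dot u (d p), p)) i) =
   (fun i => u i - sg (0 < dot u (d p)) * d p i) by [].
rewrite sqn_subZ.
have c0 : 0 < c by rewrite divr_gt0.
have -> : sg (0 < dot u (d p)) ^+ 2 = c ^+ 2 by rewrite /sg; case: ifP => // _; rewrite sqrrN.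
have -> : 2 * sg (0 < dot u (d p)) * dot u (d p) = 2 * c * `|dot u (d p)|.
  rewrite /sg; case: ifPn => [h|]; first by rewrite gtr0_norm.
  by rewrite -leNgt => h; rewrite ler0_norm //; ring.
have h1 : c ^+ 2 * sqn (d p) <= c ^+ 2 * (G * N%:R).
  by rewrite ler_wpM2l // exprn_ge0 // ltW.
have h2 : 2 * c * (delta * N%:R) <= 2 * c * `|dot u (d p)|.
  by rewrite ler_wpM2l ?ltW // mulr_gt0.
have h3 : c ^+ 2 * (G * N%:R) = delta ^+ 2 / G * N%:R.
  by rewrite /c; field; lra.
have h4 : 2 * c * (delta * N%:R) = 2 * (delta ^+ 2 / G * N%:R).
  by rewrite /c; field; lra.
rewrite -natr1 mulrBl mulrDl mul1r mulrDl; rewrite mulrBl in he.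
by rewrite h3 in h1; rewrite h4 in h2; lra.
Qed.

(** After [k > K^2 G / delta^2] rounds the squared distance would be negative, so the first
    alternative of [greedy_step] must hold. Since [k] depends on neither [N] nor [d], the number of
    centres is polynomial in [#|I|]. *)
Lemma greedy_net (R : realType) (G K delta : R) : 0 < G -> 0 < delta ->
  exists k : nat, forall N (I : finType) (d : I -> 'I_N -> R),
  (forall p, sqn (d p) <= G * N%:R) ->
  exists (J : finType) (y : J -> 'I_N -> R),
  #|J| = ((2 * #|I|).+1 ^ k)%N /\
  forall x, (forall j, `|x j| <= K) -> exists e,
   forall p, `|dot (fun i => x i - y e i) (d p)| <= delta * N%:R.
Proof.
move=> G0 d0; pose k := (Num.truncn (K ^+ 2 / (delta ^+ 2 / G))).+1.
have c0 : 0 < delta ^+ 2 / G by rewrite divr_gt0 // exprn_gt0.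
have hk : K ^+ 2 < k%:R * (delta ^+ 2 / G).
  by rewrite -ltr_pdivrMr // truncnS_gt.
exists k => N I d hd.
have [J [y [cJ hy]]] := greedy_step K k G0 d0 hd; exists J, y; split=> // x hx.
have [e [he|he]] := hy x hx; first by exists e.
(* For [N = 0] the negative bound degenerates to [0], but then every [dot] vanishes. *)
exists e; case: N I d hd J y cJ x hx hy e he => [|N] I d hd J y cJ x hx hy e he p.
  by rewrite /dot big_ord0 normr0 mulr0.
exfalso; have := sqn_ge0 (fun i => x i - y e i); apply/negP; rewrite -ltNge.
by apply: (le_lt_trans he); rewrite nmulr_rlt0 // subr_lt0.
Qed.

(** * Operator norm and degree sums *)

(** Boundedness is what makes the supremum in [opnorm] an upper bound. Vectors of the unit ball have
    coordinates at most 1 in absolute value, so the absolute row sums bound [M v]. *)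
Lemma l2norm_bounded (R : realType) N (M : 'M[R]_N) :
  has_ubound [set l2norm (M *m v) | v in [set v | l2norm v <= 1]].
Proof.
exists (Num.sqrt (\sum_i (\sum_j `|M i j|) ^+ 2)) => _ [v /= hv <-].
have v1 j : `|v j 0| <= 1.
  rewrite -sqrtr_sqr (le_trans _ hv) // ler_wsqrtr // (bigD1 j) //=.
  by rewrite lerDl sumr_ge0 // => i _; rewrite sqr_ge0.
rewrite /l2norm ler_wsqrtr // ler_sum // => i _.
rewrite -real_normK ?num_real // lerXn2r ?nnegrE ?sumr_ge0 //.
rewrite mxE; apply: (le_trans (ler_norm_sum _ _ _)); apply: ler_sum => j _.
by rewrite normrM ler_piMr.
Qed.

(** Test [M] on the unit vector with all entries [1/sqrt N], then apply Cauchy-Schwarz against the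
    constant vector. *)
Lemma sum_le_opnorm (R : realType) N (M : 'M[R]_N) :
  \sum_i \sum_j M i j <= N%:R * opnorm M.
Proof.
case: N M => [|N] M; first by rewrite big_ord0 mul0r.
set n : R := N.+1%:R.
have n0 : 0 < n by rewrite ltr0n.
have sn0 : 0 < Num.sqrt n by rewrite sqrtr_gt0.
have sn2 : Num.sqrt n ^+ 2 = n by rewrite sqr_sqrtr // ltW.
pose v : 'cV[R]_N.+1 := const_mx (Num.sqrt n)^-1.
have hv : l2norm v <= 1.
  rewrite /l2norm (eq_bigr (fun=> n^-1)).
    by rewrite sumr_const card_ord -mulr_natl mulfV ?sqrtr1 // gt_eqF.
  by move=> i _; rewrite mxE exprVn sn2.
have hL : l2norm (M *m v) <= opnorm M.
  by apply: (ub_le_sup (l2norm_bounded M)); exists v.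
set L := opnorm M in hL *.
have L0 : 0 <= L by apply: le_trans hL; rewrite /l2norm sqrtr_ge0.
pose u (i : 'I_N.+1) : R := (M *m v) i 0.
have hu : sqn u <= L ^+ 2.
  rewrite -[leLHS](@sqr_sqrtr R); last exact: sqn_ge0.
  by rewrite lerXn2r ?nnegrE ?sqrtr_ge0.
set t := \sum_i _.
have ut : \sum_i u i = t / Num.sqrt n.
  rewrite /t mulr_suml; apply: eq_bigr => i _; rewrite /u mxE mulr_suml.
  by apply: eq_bigr => j _; rewrite mxE.
(* Cauchy-Schwarz, obtained from the squared distance of [u] to the constant vector of its mean. *)
have := sqn_ge0 (fun i => u i - t / Num.sqrt n / n * 1).
rewrite sqn_subZ (_ : dot u _ = t / Num.sqrt n); last first.
  by rewrite -ut; apply: eq_bigr => i _; rewrite mulr1.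
rewrite (_ : sqn (fun=> 1) = n); last first.
  by rewrite /sqn; under eq_bigr do rewrite expr1n; rewrite sumr_const card_ord.
have -> : sqn u - 2 * (t / Num.sqrt n / n) * (t / Num.sqrt n) + (t / Num.sqrt n / n) ^+ 2 * n
   = sqn u - t ^+ 2 / (Num.sqrt n ^+ 2) / n by field; rewrite !gt_eqF.
rewrite sn2 => h.
have : t ^+ 2 <= (n * L) ^+ 2.
  rewrite exprMn mulrC -ler_pdivrMr ?exprn_gt0 //.
  have -> : t ^+ 2 / n ^+ 2 = t ^+ 2 / n / n by field; rewrite gt_eqF.
  by apply: le_trans hu; rewrite -subr_ge0.
have nL0 : 0 <= n * L by rewrite mulr_ge0 // ltW.
by move=> h2; rewrite leNgt; apply/negP => h3; nra.
Qed.

(** By symmetry of the slices, the entries of [sum_i A_i^2] add up to exactly [degree_sq A]. *)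
Lemma degree_sq_opnorm (R : realType) N (A : 'I_N -> 'I_N -> 'I_N -> R) :
  interaction_tensor A ->
  degree_sq A <= N%:R * opnorm (\sum_(i < N) slice A i ^+ 2).
Proof.
move=> hA; set M := \sum_(i < N) _.
apply: le_trans (sum_le_opnorm M); rewrite le_eqVlt; apply/orP; left; apply/eqP.
have e j k : M j k = \sum_i \sum_l A i l j * A i l k.
  rewrite /M summxE; apply: eq_bigr => i _; rewrite expr2 mxE.
  by apply: eq_bigr => l _; rewrite !mxE (tensor_swap hA i l j).
under [RHS]eq_bigr => j _ do (under eq_bigr => k _ do rewrite e).
rewrite /degree_sq.
under [RHS]eq_bigr => j _ do rewrite exchange_big /=.
rewrite [RHS]exchange_big /=; apply: eq_bigr => i _.
under [RHS]eq_bigr => j _ do rewrite exchange_big /=.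
rewrite [RHS]exchange_big /=; apply: eq_bigr => l _.
by rewrite expr2 mulr_suml; apply: eq_bigr => j _; rewrite mulr_sumr.
Qed.

(** * Trilinear form and covering by cells *)

Definition tri (R : realType) N (A : 'I_N -> 'I_N -> 'I_N -> R) (x y z : 'I_N -> R) :=
  dot x (bil A y z).

Section tri.
Context (R : realType) (N : nat) (A : 'I_N -> 'I_N -> 'I_N -> R).
Hypothesis hA : interaction_tensor A.
Implicit Types x y z u v : 'I_N -> R.

Lemma tri_swap12 x y z : tri A x y z = tri A y x z.
Proof.
rewrite /tri /dot /bil.
under eq_bigr => i _ do rewrite mulr_sumr.
under [RHS]eq_bigr => i _ do rewrite mulr_sumr.
rewrite exchange_big /=; apply: eq_bigr => i _; apply: eq_bigr => j _.
rewrite !mulr_sumr; apply: eq_bigr => k _.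
by case: (tensor_sym hA i j k) => _ -> _ _ _; ring.
Qed.

Lemma tri_swap23 x y z : tri A x y z = tri A x z y.
Proof. by rewrite /tri /dot; apply: eq_bigr => i _; rewrite bilC. Qed.

(** Telescoping in the three slots, with symmetry used to move [u - v] to the first slot each time;
    there it is paired with a [bil] vector, which the net approximates. *)
Lemma tri_diff u v : tri A u u u - tri A v v v =
  tri A (fun i => u i - v i) u u + tri A (fun i => u i - v i) v u
  + tri A (fun i => u i - v i) v v.
Proof.
have e x y : tri A (fun i => u i - v i) x y = tri A u x y - tri A v x y by exact: dotBl.
by rewrite !e [tri A v u u]tri_swap12 [tri A v v u]tri_swap23 [tri A v u v]tri_swap12; ring.
Qed.

End tri.

(** The greedy net is run with the net of local fields as test vectors, together with the all-ones
    vector for the linear term. Two points of one cell have nearly equal products with every test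
    vector, hence with every [bil A z w] for bounded [z] and [w]. *)
Lemma cell_cover (R : realType) (K gam delta eta : R) :
  0 < K -> 0 < delta -> 0 < eta ->
  exists2 eps : R, 0 < eps & exists N0 : nat,
  forall N (A : 'I_N -> 'I_N -> 'I_N -> R), (N0 <= N)%N ->
  interaction_tensor A -> (forall i, \sum_j \sum_k A i j k <= gam) ->
  degree_sq A <= eps * N%:R ->
  exists (rho : R) (I J : finType) (d : I -> 'I_N -> R) (y : J -> 'I_N -> R),
  [/\ ln #|J|%:R <= eta * N%:R,
   forall x, (forall j, `|x j| <= K) -> exists e,
     forall p, `|dot (fun i => x i - y e i) (d p)| <= rho &
   forall e u v, (forall j, `|u j| <= K) -> (forall j, `|v j| <= K) ->
    (forall p, `|dot (fun i => u i - y e i) (d p)| <= rho) ->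
    (forall p, `|dot (fun i => v i - y e i) (d p)| <= rho) ->
    `|tri A u u u - tri A v v v| <= delta * N%:R /\
    `|\sum_i (u i - v i)| <= delta * N%:R].
Proof.
move=> K0 de0 eta0.
(* Each of the three terms of [tri_diff] will cost [(5/2 + 2 K^2) de1 N]: [2 de1 N] from the two
   cell conditions, and [(4 K^2 + 1) de1 N / 2] from the net error through [dot_le]. *)
pose B : R := 3 * (5 / 2 + 2 * K ^+ 2).
have K20 : 0 < K ^+ 2 by rewrite exprn_gt0.
have B0 : 7 < B by rewrite /B; lra.
pose de1 := delta / B.
have d10 : 0 < de1 by rewrite divr_gt0 //; lra.
(* [G N] bounds the squared norm of any net vector within [de1 sqrt N] of a local field; the [+ 1]
   accommodates the all-ones vector. *)
pose G := 2 * ((K ^+ 2 * gam) ^+ 2 + de1 ^+ 2) + 1.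
have G1 : 1 <= G by rewrite /G; have := sqr_ge0 (K ^+ 2 * gam); have := sqr_ge0 de1; lra.
have [k hk] := greedy_net K (lt_le_trans ltr01 G1) d10.
(* Half of [eta] pays for [k ln #|I|], the other half for the constant [k ln 5], which [N0]
   absorbs. *)
pose eta1 := eta / (2 * k.+1%:R).
have k0 : (0 : R) < k.+1%:R by rewrite ltr0n.
have eta10 : 0 < eta1 by rewrite divr_gt0 // mulr_gt0.
have [eps eps0 heps] := low_complexity gam K0 (exprn_gt0 2 d10) eta10.
pose N0 := (Num.truncn (2 * k.+1%:R * ln 5 / eta)).+1.
exists eps => //; exists N0 => N A hN hA hg hS.
have [I [d [hI hd]]] := heps N A hA hg hS.
(* Net vectors of too large norm approximate no [bil A z w] and are replaced by zero; [None] is the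
   all-ones vector. *)
pose d' (o : option I) : 'I_N -> R := if o is Some p then
   (if sqn (d p) <= G * N%:R then d p else fun=> 0) else fun=> 1.
have hd' o : sqn (d' o) <= G * N%:R.
  have G0 : 0 <= G * N%:R by rewrite mulr_ge0 //; lra.
  case: o => [p|]; rewrite /d'.
    case: ifPn => // _; rewrite /sqn big1 // => i _.
    by rewrite expr0n.
  rewrite /sqn; under eq_bigr do rewrite expr1n.
  by rewrite sumr_const card_ord ler_peMl.
have [J [y [cJ hy]]] := hk N _ d' hd'.
exists (de1 * N%:R), (option I), J, d', y; split => //.
  rewrite cJ card_option natrX lnXn ?ltr0n // -[_ *+ k]mulr_natl.
  (* [2 (#|I| + 1) + 1 <= 5 #|I|] when [I] is nonempty; otherwise the left side is 3 and
     [ln 0 = 0]. *)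
  have h5 : ln (2 * #|I|.+1).+1%:R <= ln 5 + ln #|I|%:R :> R.
    have [->|I0] := posnP #|I|.
      by rewrite (ln0 (lexx 0)) addr0 ler_ln ?posrE // ler_nat.
    rewrite -lnM ?posrE ?ltr0n // ler_ln ?posrE ?mulr_gt0 ?ltr0n // -natrM ler_nat.
    by lia.
  have l5 : (0 : R) <= ln 5 by rewrite ln_ge0 // ler1n.
  have hN' : 2 * k.+1%:R * ln 5 <= eta * N%:R.
    rewrite [leRHS]mulrC -ler_pdivrMr //.
    by rewrite (le_trans (ltW (truncnS_gt _))) // ler_nat.
  have kk : k%:R <= k.+1%:R :> R by rewrite ler_nat.
  have hI' : k.+1%:R * ln #|I|%:R <= eta * N%:R / 2.
    apply: (@le_trans _ _ (k.+1%:R * (eta1 * N%:R))); first by rewrite ler_pM2l.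
    by rewrite /eta1 le_eqVlt; apply/orP; left; apply/eqP; field; lra.
  have s0 : 0 <= ln 5 + ln #|I|%:R :> R by rewrite addr_ge0 // ln_nat_ge0.
    apply: (le_trans (ler_wpM2l (ler0n _ _) h5)).
  by apply: (le_trans (ler_wpM2r s0 kk)); rewrite mulrDr; lra.
move=> e u v hu hv cu cv.
have huv o : `|dot (fun i => u i - v i) (d' o)| <= 2 * de1 * N%:R.
  have -> : dot (fun i => u i - v i) (d' o) =
    dot (fun i => u i - y e i) (d' o) - dot (fun i => v i - y e i) (d' o).
    by rewrite !dotBl; ring.
  have := cu o; have := cv o.
  by have := ler_normB (dot (fun i => u i - y e i) (d' o)) (dot (fun i => v i - y e i) (d' o)); lra.
have deB : de1 * B = delta by rewrite /de1; field; lra.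
have N0' : (0 : R) <= N%:R by [].
split; last first.
  have := huv None; rewrite /dot; under eq_bigr do rewrite mulr1.
  move=> /le_trans; apply; rewrite -deB ler_wpM2r //; nra.
have suv : sqn (fun i => u i - v i) <= (2 * K) ^+ 2 * N%:R.
  apply: sqn_bound => i; have := ler_normB (u i) (v i); have := hu i; have := hv i; lra.
have key z w : (forall j, `|z j| <= K) -> (forall j, `|w j| <= K) ->
    `|tri A (fun i => u i - v i) z w| <= de1 * B / 3 * N%:R.
  move=> hz hw; have [p hp] := hd z w hz hw.
  have dp : d' (Some p) = d p.
    rewrite /d' ifT //.
    have hb : sqn (bil A z w) <= (K * K * gam) ^+ 2 * N%:R.
      by apply: sqn_bound => i; apply: bil_bound => //; exact: ltW.
    have h2 : sqn (d p) <= 2 * (sqn (bil A z w) + sqn (fun i => bil A z w i - d p i)).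
      rewrite /sqn -big_split /= mulr_sumr; apply: ler_sum => i _.
      rewrite -subr_ge0 (_ : _ - _ = (2 * bil A z w i - d p i) ^+ 2) ?sqr_ge0 //.
      by ring.
    rewrite -expr2 in hb.
    by apply: (le_trans h2); rewrite /G mulrDl mul1r -mulrA mulrDl; lra.
  have h1 := huv (Some p); rewrite dp in h1.
  set du := (fun i => u i - v i) in h1 suv *.
  have e1 : tri A du z w = dot du (d p) + dot du (fun i => bil A z w i - d p i).
    by rewrite dotBr /tri; ring.
  have h2 := dot_le du (fun i => bil A z w i - d p i) d10.
  have h3 : de1 * sqn du <= de1 * ((2 * K) ^+ 2 * N%:R) by rewrite ler_pM2l.
  have h4 : sqn (fun i => bil A z w i - d p i) / de1 <= de1 * N%:R.
    by rewrite ler_pdivrMr // mulrC mulrA -expr2.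
  rewrite e1; apply: (le_trans (ler_normD _ _)).
  by rewrite /B; nra.
rewrite tri_diff // -deB.
have := key u u hu hu; have := key v u hv hu; have := key v v hv hv.
set t1 := tri _ _ _ _; set t2 := tri _ _ _ _; set t3 := tri _ _ _ _.
have := ler_normD (t3 + t2) t1; have := ler_normD t3 t2; lra.
Qed.

(** * Exponential tilts of the product measure *)

Section probability_full.
Context d (T : measurableType d) (R : realType) (P : probability T R).

Lemma probability_setC0 (E : set T) : measurable E -> P E = 1%E -> P (~` E) = 0%E.
Proof. by move=> mE PE; rewrite probability_setC // PE subee. Qed.

Lemma ge0_integral_full (E : set T) (f : T -> \bar R) : measurable E ->
  P E = 1%E -> measurable_fun setT f -> (forall x, 0 <= f x)%E ->
  (\int[P]_x f x = \int[P]_(x in E) f x)%E.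
Proof.
move=> mE PE mf f0.
rewrite (@ge0_negligible_integral _ _ _ _ setT (~` E)) ?setTD ?setCK //.
- exact: measurableC.
- exact: probability_setC0.
Qed.

End probability_full.

Section tuple_power_theory.
Context (R : realType) (mu : probability (measurableTypeR R) R).
Local Notation T := (measurableTypeR R).
Local Notation pw := (tuple_power mu).

Lemma integral_tuple_power0 (g : 0.-tuple T -> \bar R) :
  measurable_fun setT g -> (\int[pw 0]_x g x = g [tuple])%E.
Proof. by move=> mg; rewrite /= integral_dirac // diracT mul1e. Qed.

Lemma integral_tuple_powerS n (g : n.+1.-tuple T -> \bar R) :
  measurable_fun setT g -> (forall x, 0 <= g x)%E ->
  (\int[pw n.+1]_x g x = \int[mu]_x \int[pw n]_y g [tuple of x :: y])%E.
Proof.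
move=> mg g0; rewrite /= ge0_integral_distribution //.
rewrite fubini_tonelli1 //; last by move=> x /=; exact: g0.
apply: (measurableT_comp mg); exact: measurable_tuple_cons.
Qed.

Lemma measurable_cons_section n (g : n.+1.-tuple T -> R) (x : T) :
  measurable_fun setT g -> measurable_fun setT (fun y : n.-tuple T => g [tuple of x :: y]).
Proof.
move=> mg; apply: (measurableT_comp mg).
by apply: (@measurable_cons _ _ _ _ (cst x) n id); [exact: measurable_cst|exact: measurable_id].
Qed.

End tuple_power_theory.

Lemma itv_norm_le (R : realDomainType) (a b z : R) :
  a <= z <= b -> `|z| <= Num.max `|a| `|b|.
Proof.
move=> /andP[az zb]; rewrite le_max; case: (lerP 0 z) => z0.
  by rewrite (ger0_norm z0) (le_trans zb (ler_norm _)) orbT.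
by rewrite (ltr0_norm z0) -(normrN a) (le_trans _ (ler_norm _)) // lerN2.
Qed.

Section tilting.
Context (R : realType) (km kp : R) (mu : probability (measurableTypeR R) R).
Hypothesis mu_itv : mu `[km, kp]%classic = 1%E.
Local Notation T := (measurableTypeR R).
Local Notation pw := (tuple_power mu).
Local Notation Lam := (cumulant mu).

Lemma measurable_box n : measurable (box km kp : set (n.-tuple T)).
Proof.
have -> : (box km kp : set (n.-tuple T)) =
   \bigcap_(i in [set: 'I_n]) ((fun x : n.-tuple T => tnth x i) @^-1` `[km, kp]%classic).
  apply/seteqP; split => x /= h i => [_|].
    by have /= := h i; rewrite in_itv.
  by have /= := h i Logic.I; rewrite in_itv.
apply: fin_bigcap_measurable => // i _; rewrite -[X in measurable X]setTI.
by apply: measurable_tnth => //; exact: measurable_itv.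
Qed.

Lemma tuple_power_box n : pw n (box km kp) = 1%E.
Proof.
elim: n => [|n IH].
  rewrite /= diracE mem_set // => -[] //.
have mB := @measurable_box n.+1; have mB' := @measurable_box n.
have mI : measurable (`[km, kp]%classic : set T) by exact: measurable_itv.
have -> : pw n.+1 (box km kp) = (\int[pw n.+1]_x (\1_(box km kp) x)%:E)%E.
  by rewrite integral_indic ?setIT.
rewrite integral_tuple_powerS; last 2 first.
- by apply/measurable_EFinP; exact: measurable_indic.
- by move=> x; rewrite lee_fin.
have e (x : T) (y : n.-tuple T) : (\1_(box km kp) [tuple of x :: y])%:E =
    ((\1_(`[km, kp]%classic) x)%:E * (\1_(box km kp) y)%:E)%E :> \bar R.
  rewrite -EFinM !indicE -natrM mulnb; congr (_%:R%:E); congr nat_of_bool.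
  apply/idP/andP => [|[]]; rewrite !inE /= ?in_itv /=.
    move=> h; split; first by have := h ord0; rewrite tnth0.
    by move=> i; have := h (lift ord0 i); rewrite tnthS.
  move=> h1 h2 i; case: (unliftP ord0 i) => [j|] ->; last by rewrite tnth0.
  by rewrite tnthS.
have IH' : (\int[pw n]_y (\1_(box km kp) y)%:E = 1)%E.
  by rewrite integral_indic ?setIT.
under eq_integral => x _.
  under eq_integral => y _ do rewrite e.
  rewrite ge0_integralZl_EFin //; last first.
    by apply/measurable_EFinP; exact: measurable_indic.
  rewrite IH' mule1; over.
by rewrite integral_indic ?setIT.
Qed.

Lemma measurable_exp_mul l : measurable_fun setT (fun z : T => expR (l * z) : R).
Proof. by apply: measurableT_comp => //; exact: measurable_funM. Qed.

(** [cumulant] is the logarithm of a real-valued integral; the bounds [e^{-|l| K}] and [e^{|l| K}]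
    show that the integral is finite and positive, so the exponential recovers it. *)
Lemma integral_exp l : (\int[mu]_z (expR (l * z))%:E = (expR (Lam l))%:E)%E.
Proof.
pose K := Num.max `|km| `|kp|.
have mI : measurable (`[km, kp]%classic : set T) by exact: measurable_itv.
have mE : measurable_fun setT (fun z : T => (expR (l * z))%:E).
  apply/measurable_EFinP; exact: measurable_exp_mul.
have hz (z : T) : `[km, kp]%classic z -> - (`|l| * K) <= l * z <= `|l| * K.
  by rewrite /= in_itv /= => hz; rewrite -ler_norml normrM ler_wpM2l // itv_norm_le.
have := @ge0_integral_full _ _ _ mu _ (fun z => (expR (l * z))%:E) mI mu_itv mE.
move=> /(_ (fun z => expR_ge0 _)) e.
have h1 : ((expR (- (`|l| * K)))%:E <= \int[mu]_z (expR (l * z))%:E)%E.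
  rewrite e -[leLHS]mule1 -mu_itv -integral_cst //.
  apply: ge0_le_integral => //; [by move=> z _; rewrite lee_fin expR_ge0|exact: measurable_funTS|].
  by move=> z /hz /andP[hz1 _]; rewrite lee_fin ler_expR.
have h2 : (\int[mu]_z (expR (l * z))%:E <= (expR (`|l| * K))%:E)%E.
  rewrite e -[leRHS]mule1 -mu_itv -integral_cst //.
  apply: ge0_le_integral => //; first exact: measurable_funTS.
  by move=> z /hz /andP[_ hz1]; rewrite lee_fin ler_expR.
have hf : (\int[mu]_z (expR (l * z))%:E)%E \is a fin_num.
  rewrite ge0_fin_numE; first by apply: (le_lt_trans h2); rewrite ltry.
  by apply: integral_ge0 => z _; rewrite lee_fin expR_ge0.
rewrite /cumulant /Rintegral lnK ?fineK // posrE -lte_fin fineK //.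
by apply: lt_le_trans h1; rewrite lte_fin expR_gt0.
Qed.

End tilting.

(** The parameters vary independently, so near-maximisers can be chosen coordinate by coordinate.
    Fixing the other parameters at 0 shows first that every supremum is finite. This serves to bound
    [rate_tuple] by a joint supremum. *)
Lemma sum_ereal_sup_le (R : realType) n (f : 'I_n -> R -> R) (c : R) :
  (forall l : 'I_n -> R, \sum_i f i (l i) <= c) ->
  (\sum_(i < n) ereal_sup [set (f i l)%:E | l in [set: R]] <= c%:E)%E.
Proof.
move=> hf; pose s i := ereal_sup [set (f i l)%:E | l in [set: R]].
have lb i : ((f i 0)%:E <= s i)%E by apply: ereal_sup_ubound; exists 0.
have ub i : (s i <= (c - \sum_(j < n | j != i) f j 0)%:E)%E.
  apply: ge_ereal_sup => _ [l _ <-]; rewrite lee_fin lerBrDr.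
  have := hf (fun j => if j == i then l else 0).
  rewrite (bigD1 i) //= eqxx; under eq_bigr => j ji do rewrite (negPf ji).
  by [].
have sfin i : s i \is a fin_num.
  by rewrite fin_numElt (lt_le_trans _ (lb i)) ?ltNyr // (le_lt_trans (ub i)) ?ltry.
have -> : (\sum_(i < n) s i = (\sum_(i < n) fine (s i))%:E)%E.
  by rewrite -sumEFin; apply: eq_bigr => i _; rewrite fineK.
rewrite lee_fin; apply/ler_addgt0Pr => e e0.
have d0 : 0 < e / n.+1%:R by rewrite divr_gt0.
have /choice[l hl] i : exists l, fine (s i) - e / n.+1%:R <= f i l.
  have [_ [l _ <-]] := ub_ereal_sup_adherent d0 (sfin i).
  by rewrite -/(s i) -[X in (X - _)%E]fineK // -EFinB lte_fin => /ltW; exists l.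
have : \sum_i (fine (s i) - e / n.+1%:R) <= c.
  by apply: le_trans (hf l); apply: ler_sum => i _.
rewrite sumrB sumr_const card_ord -[_ *+ n]mulr_natr.
have : e / n.+1%:R * n%:R <= e.
  by rewrite mulrAC ler_pdivrMr // ler_pM2l // ler_nat.
by move=> h1; rewrite lerBlDr => h2; apply: (le_trans h2); rewrite lerD2l.
Qed.

Section tilting_tuples.
Context (R : realType) (km kp : R) (mu : probability (measurableTypeR R) R).
Hypothesis mu_itv : mu `[km, kp]%classic = 1%E.
Local Notation T := (measurableTypeR R).
Local Notation pw := (tuple_power mu).
Local Notation Lam := (cumulant mu).

Lemma measurable_dot n (l : 'I_n -> R) :
  measurable_fun [set: n.-tuple T] (fun x : n.-tuple T => dot l (tnth (x : n.-tuple R)) : R).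
Proof.
rewrite /dot; apply: measurable_sum => i; apply: measurable_funM => //.
exact: measurable_tnth.
Qed.

Lemma measurable_exp_dot n (l : 'I_n -> R) :
  measurable_fun [set: n.-tuple T] (fun x : n.-tuple T => (expR (dot l (tnth (x : n.-tuple R))))%:E).
Proof.
by apply/measurable_EFinP; apply: measurableT_comp => //; exact: measurable_dot.
Qed.

Lemma dot_cons n (l : 'I_n.+1 -> R) (x : R) (y : n.-tuple R) :
  dot l (tnth [tuple of x :: y]) = l ord0 * x + dot (fun i => l (lift ord0 i)) (tnth y).
Proof.
by rewrite /dot big_ord_recl tnth0; congr (_ + _); apply: eq_bigr => i _; rewrite tnthS.
Qed.

Lemma integral_exp_tuple n (l : 'I_n -> R) :
  (\int[pw n]_x (expR (dot l (tnth (x : n.-tuple R))))%:E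
    = (expR (\sum_i Lam (l i)))%:E)%E.
Proof.
elim: n l => [|n IH] l.
  rewrite integral_tuple_power0; last exact: measurable_exp_dot.
  by rewrite /dot !big_ord0.
rewrite integral_tuple_powerS; [|exact: measurable_exp_dot|by move=> x; rewrite lee_fin expR_ge0].
under eq_integral => x _.
  under eq_integral => y _ do rewrite dot_cons expRD EFinM.
  rewrite ge0_integralZl_EFin ?expR_ge0 //; last exact: measurable_exp_dot.
  by rewrite IH muleC; over.
rewrite ge0_integralZl_EFin ?expR_ge0 //; last first.
  by apply/measurable_EFinP; exact: measurable_exp_mul.
rewrite (integral_exp mu_itv) -EFinM -expRD big_ord_recl addrC //.
Qed.

(* Integrating one coordinate at a time, [Lam c >= c * t - rho] replaces each
   coordinate of a multi-affine function by a prescribed value. *)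
Lemma multiaffine_lower_bound n (G : n.-tuple R -> R) (t : n.-tuple R) (rho : 'I_n -> R) :
  measurable_fun [set: n.-tuple T] (G : n.-tuple T -> R) ->
  (forall (i : 'I_n) (x : n.-tuple R), exists c e, forall y : n.-tuple R,
     (forall j, j != i -> tnth y j = tnth x j) -> G y = c * tnth y i + e) ->
  (forall i l, l * tnth t i - Lam l <= rho i) ->
  ((expR (G t - \sum_i rho i))%:E <= \int[pw n]_x (expR (G x))%:E)%E.
Proof.
elim: n G t rho => [|n IH] G t rho mG aG ht.
  rewrite integral_tuple_power0; last first.
    by apply/measurable_EFinP; apply: measurableT_comp.
  by rewrite big_ord0 subr0 (tuple0 t).
have mE : measurable_fun [set: n.+1.-tuple T] (fun x => (expR (G x))%:E).
  by apply/measurable_EFinP; apply: measurableT_comp.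
rewrite integral_tuple_powerS; [|exact: mE|by move=> x; rewrite lee_fin expR_ge0].
case/tupleP: t ht => t0 t ht.
(* With the last coordinates frozen at [t], [G] is [c x + e] in the first coordinate [x]. The
   induction hypothesis reduces the inner integral to this line. *)
have [c [e hce]] := aG ord0 [tuple of t0 :: t].
have hx (x : R) : ((expR (c * x + e - \sum_(i < n) rho (lift ord0 i)))%:E <=
    \int[pw n]_y (expR (G [tuple of x :: y]))%:E)%E.
  have := IH (fun y => G [tuple of x :: y]) t (fun i => rho (lift ord0 i)).
  have -> : G [tuple of x :: t] = c * x + e.
    rewrite hce ?tnth0 // => j; case: (unliftP ord0 j) => [k|] -> //.
    by rewrite !tnthS.
  apply.
  - exact: measurable_cons_section.
  - move=> i y; have [c' [e' h]] := aG (lift ord0 i) [tuple of x :: y].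
    exists c', e' => z hz; rewrite h ?tnthS // => j.
    case: (unliftP ord0 j) => [k|] ->; last by rewrite !tnth0.
    by rewrite !tnthS => hk; apply: hz; apply: contra hk => /eqP ->.
  - by move=> i l; have := ht (lift ord0 i) l; rewrite tnthS.
(* The integral of [e^{c x}] is [e^{Lam c}], and [Lam c >= c t0 - rho_0]. *)
apply: (@le_trans _ _ (\int[mu]_x ((expR (e - \sum_(i < n) rho (lift ord0 i)))%:E * (expR (c * x))%:E))%E).
  rewrite ge0_integralZl_EFin ?expR_ge0 //; last first.
    by apply/measurable_EFinP; exact: measurable_exp_mul.
  rewrite (integral_exp mu_itv) -EFinM -expRD lee_fin ler_expR.
  rewrite hce // tnth0 big_ord_recl.
  by have := ht ord0 c; rewrite tnth0; lra.
have mF : measurable_fun setT (fun x : T => \int[pw n]_y (expR (G [tuple of x :: y]))%:E)%E.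
  apply: (@measurable_fun_fubini_tonelli_F _ _ _ _ _ (pw n)
    (fun p : T * n.-tuple T => (expR (G [tuple of p.1 :: p.2]))%:E)) => //.
  by apply: (measurableT_comp mE); exact: measurable_tuple_cons.
apply: ge0_le_integral; [exact: measurableT| | |exact: mF| ].
- by move=> x _; rewrite -EFinM lee_fin mulr_ge0 ?expR_ge0.
- apply/measurable_EFinP; apply: measurable_funM => //; exact: measurable_exp_mul.
- move=> x _; apply: le_trans (hx x); rewrite -EFinM -expRD lee_fin ler_expR; lra.
Qed.

(** [t] is the barycentre of the product measure conditioned on [C]. Averaging preserves every
    linear inequality valid on [C], so [t] lies in each closed half-space containing [C]. With [p]
    the mass of [C], Jensen gives [p e^{<l,t>} <= int_C e^{<l,x>} <= e^{sum_i Lam(l_i)}]; take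
    logarithms, then the supremum over [l]. *)
Lemma centroid n (C : set (n.-tuple T)) : measurable C ->
  C `<=` box km kp -> (0 < pw n C)%E ->
  exists t : n.-tuple R,
   (forall l c, (forall x : n.-tuple R, C x -> dot l (tnth x) <= c) -> dot l (tnth t) <= c) /\
   (rate_tuple mu t <= (- ln (fine (pw n C)))%:E)%E.
Proof.
move=> mC Cbox C0.
set p := fine (pw n C).
have pfin : pw n C \is a fin_num by exact: fin_num_measure.
have p0 : 0 < p by rewrite -lte_fin fineK.
pose K := Num.max `|km| `|kp|.
have coordK (x : n.-tuple R) i : C x -> `|tnth x i| <= K.
  by move=> /Cbox /(_ i); exact: itv_norm_le.
have intb (f : n.-tuple T -> R) B : measurable_fun setT f ->
    (forall x, C x -> `|f x| <= B) -> (pw n).-integrable C (EFin \o f).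
  move=> mf hf; apply: measurable_bounded_integrable => //.
  - by rewrite (le_lt_trans (probability_le1 _ mC)) // ltry.
  - exact: measurable_funTS.
  - exists B; split; first exact: num_real.
    by move=> M BM x Cx; apply: (le_trans (hf x Cx)); exact: ltW.
have mcoord i : measurable_fun setT (fun x : n.-tuple T => tnth (x : n.-tuple R) i : R).
  exact: measurable_tnth.
have int_coord i : (pw n).-integrable C (EFin \o (fun x : n.-tuple T => tnth (x : n.-tuple R) i : R)).
  by apply: (intb _ K) => // x Cx; exact: coordK.
have dotK l (x : n.-tuple R) : C x -> `|dot l (tnth x)| <= \sum_i `|l i| * K.
  move=> Cx; apply: (le_trans (ler_norm_sum _ _ _)); apply: ler_sum => i _.
  by rewrite normrM ler_wpM2l // coordK.
have int_dot l : (pw n).-integrable C (EFin \o (fun x : n.-tuple T => dot l (tnth (x : n.-tuple R)))).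
  by apply: (intb _ (\sum_i `|l i| * K)); [exact: measurable_dot|exact: dotK].
pose t := [tuple \int[pw n]_(x in C) tnth (x : n.-tuple R) i / p | i < n].
have Edot l : \int[pw n]_(x in C) dot l (tnth (x : n.-tuple R)) = dot l (tnth t) * p.
  have -> : dot l (tnth t) * p = \sum_i l i * \int[pw n]_(x in C) tnth (x : n.-tuple R) i.
    rewrite /dot mulr_suml; apply: eq_bigr => i _; rewrite tnth_mktuple.
    by field; rewrite gt_eqF.
  rewrite /Rintegral /dot; under eq_integral do rewrite -sumEFin.
  rewrite integral_sum //; last first.
    move=> i; rewrite (_ : (fun _ => _) = (fun x => (l i)%:E * (tnth (x : n.-tuple R) i)%:E))%E.
      exact: integrableZl (int_coord i).
    by apply/funext => x; rewrite EFinM.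
  have fin_coord i : (\int[pw n]_(x in C) (tnth (x : n.-tuple R) i)%:E)%E \is a fin_num.
    exact: (integrable_fin_num mC (int_coord i)).
  have eZ i : (\int[pw n]_(x in C) (l i * tnth (x : n.-tuple R) i)%:E =
      (l i)%:E * \int[pw n]_(x in C) (tnth (x : n.-tuple R) i)%:E)%E.
    by rewrite -(integralZl mC (int_coord i)).
  rewrite -sum_fine; last by move=> i _; rewrite eZ fin_numM.
  by apply: eq_bigr => i _; rewrite eZ fineM.
exists t; split.
  move=> l c hc; rewrite -(ler_pM2r p0) -Edot -Rintegral_cst //.
  apply: le_Rintegral => //; apply: (intb _ `|c|) => //.
apply: sum_ereal_sup_le => l; rewrite sumrB.
set L := \sum_i cumulant mu (l i).
have -> : \sum_i l i * tnth t i = dot l (tnth t) by [].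
set m := dot l (tnth t).
have mexp : measurable_fun setT (fun x : n.-tuple T => expR (dot l (tnth (x : n.-tuple R))) : R).
  by apply: measurableT_comp => //; exact: measurable_dot.
have int_exp : (pw n).-integrable C (EFin \o (fun x : n.-tuple T => expR (dot l (tnth (x : n.-tuple R))))).
  apply: (intb _ (expR (\sum_i `|l i| * K))) => // x Cx.
  by rewrite ger0_norm ?expR_ge0 // ler_expR (le_trans (ler_norm _)) // dotK.
have h1 : \int[pw n]_(x in C) expR (dot l (tnth (x : n.-tuple R))) <= expR L.
  rewrite -lee_fin /Rintegral fineK; last exact: integrable_fin_num.
  rewrite /L -integral_exp_tuple; apply: ge0_subset_integral => //.
  exact: measurable_exp_dot.
have h2 : expR m * p <= \int[pw n]_(x in C) expR (dot l (tnth (x : n.-tuple R))).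
  (* The tangent line of the exponential at [m] integrates over [C] to exactly [e^m p], because [m]
     is the mean of [<l,x>] on [C]. Comparing it with the exponential is Jensen's inequality. *)
  have -> : expR m * p = \int[pw n]_(x in C) (expR m * (1 - m) + expR m * dot l (tnth (x : n.-tuple R))).
    rewrite RintegralD //; last 2 first.
    - by apply: (intb _ `|expR m * (1 - m)|).
    - by apply: (integrableZl mC _ (int_dot l)).
    by rewrite Rintegral_cst // RintegralZl // Edot -/m -/p; ring.
  apply: le_Rintegral => //.
  - apply: (intb _ (`|expR m * (1 - m)| + expR m * \sum_i `|l i| * K)).
      by apply: measurable_funD => //; apply: measurable_funM => //; exact: measurable_dot.
    move=> x Cx; apply: (le_trans (ler_normD _ _)); rewrite lerD2l normrM.
    by rewrite (ger0_norm (expR_ge0 _)) ler_wpM2l ?expR_ge0 // dotK.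
  - move=> x Cx; have := expR_ge1Dx (dot l (tnth (x : n.-tuple R)) - m).
    move=> /(ler_wpM2l (expR_ge0 m)); rewrite -expRD; set y := dot l _.
    rewrite (_ : m + (y - m) = y); last by ring.
    by lra.
have : ln (expR m * p) <= ln (expR L).
  by rewrite ler_ln ?posrE ?expR_gt0 ?mulr_gt0 ?expR_gt0 // (le_trans h2 h1).
rewrite lnM ?posrE ?expR_gt0 // !expRK; lra.
Qed.

End tilting_tuples.

(** * Regularity of the cumulant *)

Section exp_remainder.
Context (R : realType).
Implicit Types x y E : R.

Lemma expR_sub_le x y : expR x - expR y <= expR x * (x - y).
Proof.
have := ler_wpM2l (expR_ge0 x) (expR_ge1Dx (y - x)); rewrite -expRD.
by rewrite (_ : x + (y - x) = y); [lra | ring].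
Qed.

Lemma expR_dist_le E x y : expR x <= E -> expR y <= E ->
  `|expR x - expR y| <= E * `|x - y|.
Proof.
wlog xy : x y / y <= x => [H hx hy|hx hy].
  case/orP: (le_total y x) => h; first exact: H.
  by rewrite distrC (distrC x); apply: H.
rewrite !ger0_norm ?subr_ge0 ?ler_expR //.
apply: le_trans (expR_sub_le x y) _; by rewrite ler_wpM2r // subr_ge0.
Qed.

(** Convexity gives [(x - y) e^y <= e^x - e^y <= (x - y) e^x], and the outer terms differ by
    [(x - y)(e^x - e^y)]. *)
Lemma expR_taylor2 E x y : expR x <= E -> expR y <= E ->
  `|expR x - expR y - (x - y) * expR y| <= E * (x - y) ^+ 2.
Proof.
move=> hx hy.
have h1 := expR_sub_le x y; have h2 := expR_sub_le y x.
rewrite ger0_norm; last by lra.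
have h3 := expR_dist_le hx hy.
have : (expR x - expR y) * (x - y) <= `|expR x - expR y| * `|x - y|.
  by rewrite -normrM ler_norm.
have : `|expR x - expR y| * `|x - y| <= E * `|x - y| * `|x - y| by rewrite ler_wpM2r.
rewrite -mulrA -expr2 real_normK ?num_real //; lra.
Qed.

End exp_remainder.

(** Reduces differentiation under the integral sign to a pointwise bound on the second-order
    remainder. *)
Lemma is_derive_quadratic (R : realType) (f : R -> R) (x D c : R) :
  (forall s, `|s| <= 1 -> `|f (x + s) - f x - s * D| <= c * s ^+ 2) ->
  is_derive x 1 f D.
Proof.
move=> hf.
have c0 : 0 <= c.
  by have := hf 1; rewrite normr1 expr1n mulr1 => /(_ (lexx _)); exact: le_trans.
have hc : (fun h : R => h^-1 *: (f (h *: 1 + x) - f x)) @ 0^' --> D.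
  apply/cvgrPdist_le => e e0; near=> s.
  have s0 : s != 0 by near: s; exact: nbhs_dnbhs_neq.
  have s1 : `|s| <= 1.
    by near: s; apply: dnbhs0_le.
  (* Dividing by [c + 1] covers the case [c = 0]. *)
  have se : `|s| <= e / (c + 1).
    by near: s; apply: dnbhs0_le; rewrite divr_gt0 // ltr_wpDl.
  have := hf s s1; rewrite [s *: 1]mulr1 (addrC s) => h.
  have -> : D - s^-1 *: (f (x + s) - f x) = s^-1 * (- (f (x + s) - f x - s * D)).
    by rewrite /GRing.scale /=; field.
  rewrite normrM normrN normfV ler_pdivrMl ?normr_gt0 //.
  apply: (le_trans h); rewrite -real_normK ?num_real // expr2.
  rewrite mulrCA ler_wpM2l // mulrC.
  move: se; rewrite ler_pdivlMr; last by rewrite ltr_wpDl.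
  by apply: le_trans; rewrite ler_wpM2l // lerDl.
have dv : 'D_1 f x = D by apply: cvg_lim hc.
by split => //; apply/cvg_ex; exists D.
Unshelve. all: by end_near.
Qed.

Section cumulant_derivative.
Context (R : realType) (km kp : R) (mu : probability (measurableTypeR R) R).
Hypothesis mu_itv : mu `[km, kp]%classic = 1%E.
Local Notation T := (measurableTypeR R).
Local Notation I := (`[km, kp]%classic : set T).
Let K : R := Num.max `|km| `|kp|.
Let mI : measurable I. Proof. exact: measurable_itv. Qed.

(** The moment generating function and its derivative. Both are integrated over the interval of full
    mass, where the integrands are bounded. *)
Let M (l : R) : R := \int[mu]_(z in I) expR (l * z).
Let M1 (l : R) : R := \int[mu]_(z in I) (z * expR (l * z)).

Let hK (z : R) : I z -> `|z| <= K.
Proof. by rewrite /= in_itv /=; exact: itv_norm_le. Qed.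

Let K0 : 0 <= K. Proof. by rewrite /K le_max normr_ge0. Qed.

Let intb (f : T -> R) B : measurable_fun setT f ->
  (forall z, I z -> `|f z| <= B) -> mu.-integrable I (EFin \o f).
Proof.
move=> mf hf; apply: measurable_bounded_integrable => //.
- by rewrite (le_lt_trans (probability_le1 mu mI)) // ltry.
- exact: measurable_funTS.
- exists B; split; first exact: num_real.
  by move=> B' BB' z Iz; apply: (le_trans (hf z Iz)); exact: ltW.
Qed.

Let Rcst r : \int[mu]_(z in I) r = r.
Proof.
by rewrite Rintegral_cst // -[RHS]mulr1; congr (_ * _); exact: (congr1 fine mu_itv).
Qed.

Let Rint_le (f : T -> R) B : measurable_fun setT f ->
  (forall z, I z -> `|f z| <= B) -> `|\int[mu]_(z in I) f z| <= B.
Proof.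
move=> mf hf; apply: le_trans (le_normr_Rintegral mI (intb mf hf)) _.
rewrite -[leRHS]Rcst.
apply: le_Rintegral => //.
- apply: (intb (B := B)); first exact: measurableT_comp.
  by move=> z Iz; rewrite normr_id hf.
- by apply: (intb (B := `|B|)).
Qed.

Let mexp l : measurable_fun setT (fun z : T => expR (l * z) : R).
Proof. exact: measurable_exp_mul. Qed.

Let mzexp l : measurable_fun setT (fun z : T => z * expR (l * z) : R).
Proof. by apply: measurable_funM => //; exact: mexp. Qed.

Let exp_le C l z : I z -> `|l| <= C -> expR (l * z) <= expR (C * K).
Proof.
move=> Iz lC; rewrite ler_expR (le_trans (ler_norm _)) // normrM ler_pM //.
exact: hK.
Qed.

Let iexp l : mu.-integrable I (EFin \o (fun z : T => expR (l * z))).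
Proof.
apply: (intb (B := expR (`|l| * K))) => // z Iz.
by rewrite ger0_norm ?expR_ge0 // exp_le.
Qed.

Let izexp l : mu.-integrable I (EFin \o (fun z : T => z * expR (l * z))).
Proof.
apply: (intb (B := K * expR (`|l| * K))) => // z Iz.
by rewrite normrM ler_pM ?hK // ger0_norm ?expR_ge0 // exp_le.
Qed.

Let M_lower C l : `|l| <= C -> expR (- (C * K)) <= M l.
Proof.
move=> lC.
rewrite -[leLHS]Rcst.
apply: le_Rintegral => //; first by apply: (intb (B := `|expR (- (C * K))|)).
move=> z Iz; rewrite ler_expR lerNl -mulNr (le_trans (ler_norm _)) // normrM ler_pM ?hK //.
by rewrite normrN.
Qed.

Let cumulantE l : cumulant mu l = ln (M l).
Proof.
rewrite /cumulant /M /Rintegral (@ge0_integral_full _ _ _ mu I) //.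
by apply/measurable_EFinP; exact: mexp.
Qed.

Let M_diff C l l' : `|l| <= C -> `|l'| <= C ->
  `|M l - M l'| <= expR (C * K) * K * `|l - l'|.
Proof.
move=> hl hl'; rewrite /M -RintegralB //.
apply: Rint_le; first by apply: measurable_funB; exact: mexp.
move=> z Iz; apply: (le_trans (expR_dist_le (exp_le Iz hl) (exp_le Iz hl'))).
rewrite -mulrBl normrM -mulrA ler_wpM2l ?expR_ge0 // mulrC ler_wpM2r // hK //.
Qed.

Let M1_diff C l l' : `|l| <= C -> `|l'| <= C ->
  `|M1 l - M1 l'| <= expR (C * K) * K ^+ 2 * `|l - l'|.
Proof.
move=> hl hl'; rewrite /M1 -RintegralB //.
apply: Rint_le; first by apply: measurable_funB; exact: mzexp.
move=> z Iz; rewrite -mulrBr normrM.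
have h := expR_dist_le (exp_le Iz hl) (exp_le Iz hl').
rewrite -mulrBl normrM in h.
apply: (@le_trans _ _ (K * (expR (C * K) * (`|l - l'| * K)))).
  apply: ler_pM => //; first exact: hK.
  apply: (le_trans h); rewrite ler_wpM2l ?expR_ge0 // ler_wpM2l //; exact: hK.
by rewrite le_eqVlt; apply/orP; left; apply/eqP; ring.
Qed.

Let M1_bound C l : `|l| <= C -> `|M1 l| <= K * expR (C * K).
Proof.
move=> hl; apply: Rint_le; first exact: mzexp.
by move=> z Iz; rewrite normrM ler_pM ?hK // ger0_norm ?expR_ge0 // exp_le.
Qed.

(** By [expR_taylor2], the remainder of the integrand is at most [e^{(|l|+1) K} K^2 s^2] for
    [|s| <= 1]. *)
Let M_derive (l : R) : is_derive l (1 : R) M (M1 l).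
Proof.
apply: (@is_derive_quadratic _ _ _ _ (expR ((`|l| + 1) * K) * K ^+ 2)) => s hs.
have hl : `|l| <= `|l| + 1 by rewrite lerDl.
have hls : `|l + s| <= `|l| + 1.
  by apply: (le_trans (ler_normD _ _)); rewrite lerD2l.
have -> : M (l + s) - M l - s * M1 l = \int[mu]_(z in I)
    (expR ((l + s) * z) - expR (l * z) - s * (z * expR (l * z))).
  rewrite RintegralB //; last 2 first.
  - exact: (integrableB mI (iexp _) (iexp _)).
  - exact: (integrableZl mI _ (izexp l)).
  by rewrite RintegralB // RintegralZl.
apply: Rint_le.
  by apply: measurable_funB; [apply: measurable_funB; exact: mexp|apply: measurable_funM => //; exact: mzexp].
move=> z Iz; have := expR_taylor2 (exp_le Iz hls) (exp_le Iz hl).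
have -> : (l + s) * z - l * z = s * z by ring.
rewrite mulrA => /le_trans; apply.
rewrite -mulrA ler_wpM2l ?expR_ge0 // exprMn mulrC ler_wpM2r ?sqr_ge0 //.
by rewrite -real_normK ?num_real // lerXn2r ?nnegrE // hK.
Qed.

Lemma cumulant_derive l : derive1 (cumulant mu) l = M1 l / M l.
Proof.
have Ml : 0 < M l by apply: lt_le_trans (M_lower (lexx _)); exact: expR_gt0.
have -> : cumulant mu = @ln R \o M by apply/funext => x; rewrite cumulantE.
have := is_derive1_comp (is_derive1_ln Ml) (M_derive l).
by move=> /(@derive_val _ _ _ _ _ _ _); rewrite derive1E mulrC.
Qed.

Lemma cumulant_derive_lipschitz C : exists2 L, 0 <= L &
  forall u v, `|u| <= C -> `|v| <= C ->
  `|derive1 (cumulant mu) u - derive1 (cumulant mu) v| <= L * `|u - v|.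
Proof.
set E := expR (C * K).
have E0 : 0 < E by exact: expR_gt0.
exists (E ^+ 2 * K ^+ 2 + E ^+ 4 * K ^+ 2).
  by rewrite addr_ge0 // mulr_ge0 // exprn_ge0 // ltW.
move=> u v hu hv; rewrite !cumulant_derive.
have inv w : `|w| <= C -> 0 < M w /\ 0 <= (M w)^-1 <= E.
  move=> hw; have Mw := M_lower hw.
  have Mw0 : 0 < M w by apply: lt_le_trans Mw; exact: expR_gt0.
  split=> //; rewrite invr_ge0 (ltW Mw0) /= /E -[E in _ <= E]invrK -expRN.
  by rewrite lef_pV2 ?posrE ?expR_gt0.
have [Mu /andP[iu0 iuE]] := inv u hu; have [Mv /andP[iv0 ivE]] := inv v hv.
have -> : M1 u / M u - M1 v / M v =
   (M1 u - M1 v) * (M u)^-1 + M1 v * ((M v - M u) * ((M u)^-1 * (M v)^-1)).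
  by field; rewrite !gt_eqF.
apply: (le_trans (ler_normD _ _)); rewrite !normrM mulrDl; apply: lerD.
  apply: (@le_trans _ _ (E * K ^+ 2 * `|u - v| * E)).
    by apply: ler_pM => //; [exact: M1_diff|rewrite ger0_norm].
  by rewrite le_eqVlt; apply/orP; left; apply/eqP; ring.
apply: (@le_trans _ _ (K * E * (E * K * `|u - v| * (E * E)))).
  apply: ler_pM => //; first exact: M1_bound.
  apply: ler_pM => //; first by rewrite (distrC u); apply: M_diff.
  by apply: ler_pM => //; rewrite ger0_norm.
by rewrite le_eqVlt; apply/orP; left; apply/eqP; ring.
Qed.

End cumulant_derivative.

(** * Free energy *)

Section affine.
Context (R : realType) (n : nat) (i : 'I_n) (x : n.-tuple R).

(** [y] runs over the line through [x] in direction [i], so slope and intercept may depend on the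
    other coordinates of [x]. This is the form that [multiaffine_lower_bound] takes. *)
Definition affine_at (G : n.-tuple R -> R) := exists c e, forall y : n.-tuple R,
  (forall j, j != i -> tnth y j = tnth x j) -> G y = c * tnth y i + e.

Lemma affine_at_coord j : affine_at (fun y => tnth y j).
Proof.
have [->|ji] := eqVneq j i; first by exists 1, 0 => y _; rewrite mul1r addr0.
by exists 0, (tnth x j) => y /(_ j ji) ->; rewrite mul0r add0r.
Qed.

Lemma affine_at_sum I (s : seq I) (F : I -> n.-tuple R -> R) :
  (forall k, affine_at (F k)) -> affine_at (fun y => \sum_(k <- s) F k y).
Proof.
move=> hF; elim: s => [|k s [c [e h]]].
  by exists 0, 0 => y _; rewrite big_nil mul0r addr0.
have [c' [e' h']] := hF k; exists (c' + c), (e' + e) => y hy.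
by rewrite big_cons h // h' //; ring.
Qed.

Lemma affine_at_scale a G : affine_at G -> affine_at (fun y => a * G y).
Proof. by move=> [c [e h]]; exists (a * c), (a * e) => y hy; rewrite h //; ring. Qed.

Lemma affine_at_add F G : affine_at F -> affine_at G -> affine_at (fun y => F y + G y).
Proof.
move=> [c [e h]] [c' [e' h']]; exists (c + c'), (e + e') => y hy.
by rewrite h // h' //; ring.
Qed.

End affine.

Section hamiltonian.
Context (R : realType) (N : nat) (A : 'I_N -> 'I_N -> 'I_N -> R) (beta h : R).
Hypothesis hA : interaction_tensor A.
Local Notation H := (hamiltonian A beta h).

(** Monomials with a repeated index have coefficient zero by [tensor_diag], so each coordinate
    occurs in a monomial to degree at most one. *)
Lemma hamiltonian_affine i x : affine_at i x H.
Proof.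
apply: affine_at_add; apply: affine_at_scale; last first.
  by apply: affine_at_sum => k; exact: affine_at_coord.
apply: affine_at_sum => a; apply: affine_at_sum => b; apply: affine_at_sum => c.
have [abc|] := boolP [&& a != b, b != c & a != c]; last first.
  move=> /(tensor_diag hA) e; exists 0, 0 => y _.
  by rewrite e !mul0r addr0.
case/and3P: abc => ab bc ac.
have [ai|ai] := eqVneq a i.
  exists (A a b c * tnth x b * tnth x c), 0 => y hy.
  by rewrite (hy b) ?(hy c) -?ai 1?eq_sym //; ring.
have [bi|bi] := eqVneq b i.
  exists (A a b c * tnth x a * tnth x c), 0 => y hy.
  by rewrite (hy a) ?(hy c) -?bi // 1?eq_sym //; ring.
have [c' [e' hc]] := affine_at_coord i x c.
exists (A a b c * tnth x a * tnth x b * c'), (A a b c * tnth x a * tnth x b * e') => y hy.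
by rewrite (hy a) // (hy b) // hc //; ring.
Qed.

Lemma hamiltonianE (x : N.-tuple R) :
  H x = beta / 3 * tri A (tnth x) (tnth x) (tnth x) + h * \sum_i tnth x i.
Proof.
rewrite /hamiltonian /tri /dot; congr (_ * _ + _); apply: eq_bigr => i _.
rewrite /bil mulr_sumr; apply: eq_bigr => j _; rewrite mulr_sumr.
by apply: eq_bigr => k _; ring.
Qed.

Lemma measurable_hamiltonian :
  measurable_fun [set: N.-tuple (measurableTypeR R)] (H : N.-tuple (measurableTypeR R) -> R).
Proof.
have mt i : measurable_fun [set: N.-tuple (measurableTypeR R)]
    (fun x : N.-tuple (measurableTypeR R) => tnth (x : N.-tuple R) i : R).
  exact: measurable_tnth.
apply: measurable_funD; apply: measurable_funM => //; last first.
  by apply: measurable_sum => i.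
apply: measurable_sum => i; apply: measurable_sum => j; apply: measurable_sum => k.
by do 3 apply: measurable_funM => //.
Qed.

Lemma hamiltonian_bounded K gam : 0 <= K ->
  (forall i, \sum_j \sum_k A i j k <= gam) ->
  exists B, forall x : N.-tuple R, (forall i, `|tnth x i| <= K) -> `|H x| <= B.
Proof.
move=> K0 hg; exists (`|beta / 3| * (\sum_(i < N) K * (K * K * gam)) + `|h| * \sum_(i < N) K).
move=> x hx; rewrite hamiltonianE; apply: (le_trans (ler_normD _ _)).
rewrite !normrM; apply: lerD; apply: ler_wpM2l => //.
  apply: (le_trans (ler_norm_sum _ _ _)); apply: ler_sum => i _.
  by rewrite normrM ler_pM // bil_bound.
by apply: (le_trans (ler_norm_sum _ _ _)); apply: ler_sum => i _.
Qed.

End hamiltonian.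

(** The box is cut out by half-spaces: test with plus and minus each coordinate vector. It places
    centroids in the box. *)
Lemma halfspace_hull_box (R : realType) (km kp : R) n (C : set (n.-tuple R)) (t : n.-tuple R) :
  C `<=` box km kp ->
  (forall l c, (forall x : n.-tuple R, C x -> dot l (tnth x) <= c) -> dot l (tnth t) <= c) ->
  box km kp t.
Proof.
move=> CB ht i; pose l c (j : 'I_n) : R := if j == i then c else 0.
have dl c (x : n.-tuple R) : dot (l c) (tnth x) = c * tnth x i.
  rewrite /dot (bigD1 i) //= /l eqxx big1 ?addr0 // => j /negPf ->.
  by rewrite mul0r.
apply/andP; split.
  have := ht (l (-1)) (- km); rewrite dl => hh.
  suff : -1 * tnth t i <= - km by lra.
  by apply: hh => x /CB /(_ i) /andP[]; rewrite dl; lra.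
have := ht (l 1) kp; rewrite dl => hh.
suff : 1 * tnth t i <= kp by lra.
by apply: hh => x /CB /(_ i) /andP[]; rewrite dl; lra.
Qed.

Section free_energy.
Context (R : realType) (km kp : R) (mu : probability (measurableTypeR R) R).
Hypothesis mu_itv : mu `[km, kp]%classic = 1%E.
Local Notation T := (measurableTypeR R).
Local Notation pw := (tuple_power mu).

(** The [+ 1] makes the radius positive whatever the endpoints are. *)
Definition box_radius : R := Num.max `|km| `|kp| + 1.

Lemma box_radius_gt0 : 0 < box_radius.
Proof. by rewrite /box_radius ltr_wpDl // le_max normr_ge0. Qed.

Lemma box_coord_le n (x : n.-tuple R) i : box km kp x -> `|tnth x i| <= box_radius.
Proof.
by move=> /(_ i) /itv_norm_le h; rewrite /box_radius (le_trans h) // lerDl.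
Qed.

Context (N : nat) (A : 'I_N -> 'I_N -> 'I_N -> R) (beta h gam : R).
Hypothesis hA : interaction_tensor A.
Hypothesis hgam : forall i, \sum_j \sum_k A i j k <= gam.
Local Notation H := (hamiltonian A beta h).
Local Notation Z := (partition_function mu A beta h).

Let mH : measurable_fun [set: N.-tuple T] (fun x : N.-tuple T => (expR (H x))%:E).
Proof.
by apply/measurable_EFinP; apply: measurableT_comp => //; exact: measurable_hamiltonian.
Qed.

Lemma integral_exp_hamiltonian_box :
  (\int[pw N]_x (expR (H x))%:E = \int[pw N]_(x in box km kp) (expR (H x))%:E)%E.
Proof.
apply: ge0_integral_full => //; first exact: (@measurable_box _ km kp).
exact: (tuple_power_box mu_itv).
Qed.

Lemma integral_exp_hamiltonian_le (C : set (N.-tuple T)) B : measurable C ->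
  (forall x, C x -> H x <= B) ->
  (\int[pw N]_(x in C) (expR (H x))%:E <= (expR B)%:E * pw N C)%E.
Proof.
move=> mC hC; rewrite -integral_cst //.
apply: ge0_le_integral => //.
- exact: measurable_funTS.
- by move=> x Cx; rewrite lee_fin ler_expR hC.
Qed.

Lemma integral_partition_function :
  (\int[pw N]_x (expR (H x))%:E = Z%:E)%E /\ 0 < Z.
Proof.
have [B hB] := hamiltonian_bounded beta h hA (ltW box_radius_gt0) hgam.
have mB := @measurable_box _ km kp N.
have hB' (x : N.-tuple R) : box km kp x -> - B <= H x <= B.
  by move=> bx; rewrite -ler_norml hB // => i; exact: box_coord_le.
have h1 : (\int[pw N]_x (expR (H x))%:E <= (expR B)%:E)%E.
  rewrite integral_exp_hamiltonian_box.
  apply: le_trans (integral_exp_hamiltonian_le (B := B) mB _) _.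
    by move=> x /hB' /andP[].
  by rewrite (tuple_power_box mu_itv) mule1.
have h2 : ((expR (- B))%:E <= \int[pw N]_x (expR (H x))%:E)%E.
  rewrite integral_exp_hamiltonian_box -[leLHS]mule1 -(tuple_power_box mu_itv N) -integral_cst //.
  apply: ge0_le_integral => //.
  - by move=> x _; rewrite lee_fin expR_ge0.
  - exact: measurable_funTS.
  - by move=> x /hB' /andP[hx _]; rewrite lee_fin ler_expR.
have fin : (\int[pw N]_x (expR (H x))%:E)%E \is a fin_num.
  rewrite fin_numElt (lt_le_trans _ h2) ?ltNyr // (le_lt_trans h1) // ltry //.
split; first by rewrite /partition_function /Rintegral fineK.
rewrite /partition_function /Rintegral -lte_fin fineK //.
by apply: lt_le_trans h2; rewrite lte_fin expR_gt0.
Qed.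

Lemma rate_ge0 t : (0 <= rate mu t)%E.
Proof.
apply: ereal_sup_ubound; exists 0 => //.
rewrite mul0r sub0r; congr (_%:E).
have e0 : (\int[mu]_z (expR (0 * z))%:E = 1)%E.
  under eq_integral do rewrite mul0r expR0.
  by rewrite integral_cst // mul1e; exact: probability_setT.
have := integral_exp mu_itv 0; rewrite e0 => -[] e.
have := congr1 (@ln R) e.
by rewrite ln1 expRK => <-; rewrite oppr0.
Qed.

(** The lower bound on [Z]. If some coordinate of [t] has infinite rate, the value is [-oo];
    otherwise [multiaffine_lower_bound] applies, with the finite rates as [rho]. *)
Lemma mean_field_sup_le : (mean_field_sup mu A beta h km kp <= (ln Z)%:E)%E.
Proof.
have [eZ Z0] := integral_partition_function.
apply: ge_ereal_sup => _ [t bt <-].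
have [/existsP[i /eqP hi]|] := boolP [exists i : 'I_N, rate mu (tnth t i) == +oo%E].
  rewrite /rate_tuple (bigD1 i) //= hi addye ?addeNy ?leNye //.
  by rewrite gt_eqF // (lt_le_trans ltNy0) // sume_ge0 // => j _; exact: rate_ge0.
rewrite negb_exists => /forallP hf.
have fr i : rate mu (tnth t i) \is a fin_num.
  by rewrite ge0_fin_numE ?rate_ge0 // lt_neqAle hf leey.
have -> : (rate_tuple mu t = (\sum_i fine (rate mu (tnth t i)))%:E)%E.
  by rewrite -sumEFin; apply: eq_bigr => i _; rewrite fineK.
rewrite -EFinB lee_fin -ler_expR lnK ?posrE // -lee_fin -eZ.
apply: (multiaffine_lower_bound mu_itv).
- exact: measurable_hamiltonian.
- move=> i x; exact: hamiltonian_affine.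
- by move=> i l; rewrite -lee_fin fineK //; apply: ereal_sup_ubound; exists l.
Qed.

(** The supremum is at most [ln Z]. From below, the centroid of the whole box, which has mass 1, has
    rate at most [- ln 1 = 0]. *)
Lemma mean_field_sup_fin_num : mean_field_sup mu A beta h km kp \is a fin_num.
Proof.
rewrite fin_numElt (le_lt_trans mean_field_sup_le) ?ltry // andbT.
have P1 := tuple_power_box mu_itv N.
have P0 : (0 < pw N (box km kp))%E by rewrite P1.
have [t [ht rt]] := centroid mu_itv (@measurable_box _ km kp N) (@subset_refl _ _) P0.
have bt := halfspace_hull_box (@subset_refl _ _) ht.
apply: (@lt_le_trans _ _ ((H t)%:E - rate_tuple mu t)%E); last first.
  by apply: ereal_sup_ubound; exists t.
rewrite P1 in rt; move: rt; case: (rate_tuple mu t) => [r| |] //= _.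
by rewrite -EFinB ltNyr.
Qed.

End free_energy.

(** [Z] is at most the number of cells times the largest cell integral. One half of [eta] pays for
    [ln #|J|], the other for the variation of the Hamiltonian on a cell. *)
Lemma mean_field_upper_bound (R : realType) (km kp : R)
    (mu : probability (measurableTypeR R) R) (beta h gam eta : R) :
  mu `[km, kp]%classic = 1%E -> 0 < eta ->
  exists2 eps : R, 0 < eps & exists N0 : nat,
  forall N (A : 'I_N -> 'I_N -> 'I_N -> R), (N0 <= N)%N ->
  interaction_tensor A -> (forall i, \sum_j \sum_k A i j k <= gam) ->
  degree_sq A <= eps * N%:R ->
  ((ln (partition_function mu A beta h))%:E
     <= mean_field_sup mu A beta h km kp + (eta * N%:R)%:E)%E.
Proof.
move=> mu_itv eta0; set K := box_radius km kp.
have K0 : 0 < K by exact: box_radius_gt0.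
pose B := `|beta| + `|h| + 1.
have B0 : 0 < B by rewrite /B ltr_wpDl // addr_ge0.
pose delta := eta / 2 / B.
have d0 : 0 < delta by rewrite !divr_gt0.
have e20 : 0 < eta / 2 by rewrite divr_gt0.
have [eps eps0 [N0 hN]] := cell_cover gam K0 d0 e20.
exists eps => //; exists N0 => N A NN hA hg hS.
have [rho [I [J [d [y [hJ hcov hcell]]]]]] := hN N A NN hA hg hS.
set H := hamiltonian A beta h; set P := tuple_power mu N.
pose C e : set (N.-tuple R) := [set x | box km kp x /\
  forall p, `|dot (fun i => tnth x i - y e i) (d p)| <= rho].
have mC e : measurable (C e : set (N.-tuple (measurableTypeR R))).
  have -> : C e = box km kp `&` \bigcap_(p in [set: I])
      ((fun x : N.-tuple R => dot (d p) (tnth x)) @^-1`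
        `[dot (d p) (y e) - rho, dot (d p) (y e) + rho]%classic).
    have dC p (x : N.-tuple R) : dot (fun i => tnth x i - y e i) (d p) =
        dot (d p) (tnth x) - dot (d p) (y e).
      by rewrite dotBl; congr (_ - _); apply: eq_bigr => i _; rewrite mulrC.
    apply/seteqP; split => x /= [bx hx]; split => // p.
      by move=> _ /=; rewrite in_itv /=; move: (hx p); rewrite dC ler_norml => /andP[]; lra.
    by have := hx p Logic.I; rewrite dC ler_norml /= in_itv /= => /andP[]; lra.
  apply: measurableI; first exact: measurable_box.
  apply: fin_bigcap_measurable => // p _; rewrite -[X in measurable X]setTI.
  by apply: measurable_dot => //; exact: measurable_itv.
have fin := mean_field_sup_fin_num mu_itv beta h hA hg.
set S := fine (mean_field_sup mu A beta h km kp).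
have SE : mean_field_sup mu A beta h km kp = S%:E by rewrite /S fineK.
have N0' : (0 : R) <= N%:R by [].
have Hdiff e (u v : N.-tuple R) : C e u -> C e v -> H u - H v <= eta / 2 * N%:R.
  move=> [bu cu] [bv cv].
  have [h1 h2] := hcell e _ _ (fun i => box_coord_le i bu) (fun i => box_coord_le i bv) cu cv.
  rewrite /H !hamiltonianE //.
  have -> : beta / 3 * tri A (tnth u) (tnth u) (tnth u) + h * (\sum_i tnth u i) -
     (beta / 3 * tri A (tnth v) (tnth v) (tnth v) + h * (\sum_i tnth v i)) =
     beta / 3 * (tri A (tnth u) (tnth u) (tnth u) - tri A (tnth v) (tnth v) (tnth v))
     + h * \sum_i (tnth u i - tnth v i) by rewrite sumrB; ring.
  apply: (le_trans (ler_norm _)); apply: (le_trans (ler_normD _ _)); rewrite !normrM.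
  have dN : 0 <= delta * N%:R by rewrite mulr_ge0 // ltW.
  have -> : eta / 2 * N%:R = B * (delta * N%:R).
    by rewrite mulrA [B * _]mulrC divfK ?gt_eqF.
  have h3 := ler_wpM2l (normr_ge0 (beta / 3)) h1.
  have h4 := ler_wpM2l (normr_ge0 h) h2.
  have h5 : `|beta / 3| <= `|beta|.
    by rewrite normrM ler_piMr // ger0_norm //; lra.
  have h6 := ler_wpM2r dN h5.
  by rewrite normrM in h3 h6; rewrite /B !mulrDl mul1r; lra.
have [eZ Z0] := integral_partition_function mu_itv beta h hA hg.
(* Null cells contribute nothing. On a cell of mass [r > 0] with centroid [t], the integral is at
   most [r e^{H(t) + eta N/2}], and [ln r <= -I(t)]. *)
have cell_le e : (\int[P]_(x in C e) (expR (H x))%:E <= (expR (S + eta / 2 * N%:R))%:E)%E.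
  have [P0|P0] := eqVneq (P (C e)) 0%E.
    have [B' hB'] := hamiltonian_bounded beta h hA (ltW K0) hg.
    apply: le_trans (integral_exp_hamiltonian_le mu (beta := beta) (h := h) (B := B') (mC e) _) _.
      move=> x [bx _]; apply: (le_trans (ler_norm _)); apply: hB' => i; exact: box_coord_le.
    by rewrite [X in (_ * X)%E]P0 mule0 lee_fin expR_ge0.
  have Ppos : (0 < P (C e))%E by rewrite lt_neqAle eq_sym P0 measure_ge0.
  have CB : C e `<=` box km kp by move=> x [].
  have [t [ht rt]] := centroid mu_itv (mC e) CB Ppos.
  have bt := halfspace_hull_box CB ht.
  (* The cell is an intersection of closed half-spaces, so it contains its centroid. *)
  have Ct : C e t.
    split=> // p; rewrite dotBl ler_norml; apply/andP; split.
      have := ht (fun i => - d p i) (rho - dot (y e) (d p)).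
      have dN (x : 'I_N -> R) : dot (fun i => - d p i) x = - dot x (d p).
        by rewrite /dot -sumrN; apply: eq_bigr => i _; ring.
      rewrite dN => hh; suff : - dot (tnth t) (d p) <= rho - dot (y e) (d p) by lra.
      apply: hh => x [_ /(_ p)]; rewrite dN dotBl ler_norml => /andP[]; lra.
    have := ht (d p) (rho + dot (y e) (d p)).
    have dC (x : 'I_N -> R) : dot (d p) x = dot x (d p).
      by rewrite /dot; apply: eq_bigr => i _; ring.
    rewrite dC => hh; suff : dot (tnth t) (d p) <= rho + dot (y e) (d p) by lra.
    apply: hh => x [_ /(_ p)]; rewrite dC dotBl ler_norml => /andP[]; lra.
  apply: le_trans (integral_exp_hamiltonian_le mu (beta := beta) (h := h) (B := H t + eta / 2 * N%:R) (mC e) _) _.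
    by move=> x Cx; have := Hdiff e x t Cx Ct; rewrite -/H; lra.
  have Pfin : P (C e) \is a fin_num by exact: fin_num_measure.
  set r := fine (P (C e)) in rt.
  have r0 : 0 < r by rewrite -lte_fin fineK.
  have hS' : H t + ln r <= S.
    rewrite -lee_fin -SE; apply: (@le_trans _ _ ((H t)%:E - rate_tuple mu t)%E); last first.
      by apply: ereal_sup_ubound; exists t.
    by rewrite EFinD leeD2l // -[leLHS]oppeK leeN2.
  have -> : P (C e) = r%:E by rewrite fineK.
  rewrite -EFinM lee_fin -[r in leLHS]lnK ?posrE // -expRD ler_expR; lra.
have Zle : partition_function mu A beta h <= #|J|%:R * expR (S + eta / 2 * N%:R).
  rewrite -lee_fin -eZ (integral_exp_hamiltonian_box mu_itv).
  rewrite integral_mkcond.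
  have mH : measurable_fun [set: N.-tuple (measurableTypeR R)] (fun x => (expR (H x))%:E).
    by apply/measurable_EFinP; apply: measurableT_comp => //; exact: measurable_hamiltonian.
  have mHr (D : set (N.-tuple (measurableTypeR R))) : measurable D ->
      measurable_fun setT ((fun x => (expR (H x))%:E) \_ D).
    by move=> mD; apply/(measurable_restrictT _ mD); exact: measurable_funTS.
  have r0 (D : set (N.-tuple R)) x : (0 <= ((fun x => (expR (H x))%:E) \_ D) x)%E.
    by rewrite patchE; case: ifP => // _; rewrite lee_fin expR_ge0.
  (* Cells may overlap; since the integrand is nonnegative, it suffices that they cover the box. *)
  apply: (@le_trans _ _ (\int[P]_x \sum_e ((fun x => (expR (H x))%:E) \_ (C e)) x)%E).
    apply: ge0_le_integral => //.
    - by apply: mHr; exact: measurable_box.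
    - by apply: emeasurable_sum => e; apply: mHr.
    - move=> x _; rewrite patchE; case: ifPn => [|_]; last by apply: sume_ge0 => e _; exact: r0.
      rewrite inE => bx; have [e he] := hcov (tnth x) (fun i => box_coord_le i bx).
      rewrite (bigD1 e) //= [X in (_ <= X + _)%E]patchE mem_set; last by split.
      by rewrite leeDl // sume_ge0 // => e' _; exact: r0.
  rewrite ge0_integral_sum; [|exact: measurableT|by move=> e; apply: mHr|by move=> e x _; apply: r0].
  apply: (@le_trans _ _ (\sum_(e : J) (expR (S + eta / 2 * N%:R))%:E)%E).
    by apply: lee_sum => e _; rewrite -integral_mkcond.
  by rewrite sumEFin sumr_const lee_fin -[_ *+ _]mulr_natl.
have J0 : (0 < #|J|)%N.
  rewrite lt0n; apply: contraTneq Zle => ->; rewrite mul0r -ltNge //.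
have : ln (partition_function mu A beta h) <= ln (#|J|%:R * expR (S + eta / 2 * N%:R)).
  by rewrite ler_ln ?posrE // mulr_gt0 ?expR_gt0 // ltr0n.
rewrite lnM ?posrE ?expR_gt0 ?ltr0n // expRK SE -EFinD lee_fin; lra.
Qed.

(** * Nets of conditional means *)

Lemma ln_nat_le (R : realType) m n : (m <= n)%N -> ln m%:R <= ln n%:R :> R.
Proof.
case: m => [|m] mn; first by rewrite (ln0 (lexx 0)) ln_nat_ge0.
by rewrite ler_ln ?posrE ?ltr0n ?ler_nat // (leq_trans _ mn).
Qed.

(** Points whose local fields are close to the same [d p] have close conditional means, as [Lam'] is
    Lipschitz. A net must lie in the set itself, so one representative is chosen for each [p] that
    has such a point. *)
Lemma cond_mean_net (R : realType) (km kp : R)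
    (mu : probability (measurableTypeR R) R) (beta h gam delta : R) :
  mu `[km, kp]%classic = 1%E -> 0 < delta ->
  exists2 tau : R, 0 < tau &
  forall N (A : 'I_N -> 'I_N -> 'I_N -> R) (I : finType) (d : I -> 'I_N -> R),
  interaction_tensor A -> (forall i, \sum_j \sum_k A i j k <= gam) ->
  (forall z w, (forall j, `|z j| <= box_radius km kp) ->
     (forall j, `|w j| <= box_radius km kp) ->
     exists p, sqn (fun i => bil A z w i - d p i) <= tau * N%:R) ->
  exists D : {fset 'cV[R]_N},
    l2net (cond_mean mu A beta h @` box km kp) (delta * Num.sqrt N%:R) D /\
    (#|` D| <= #|I|)%N.
Proof.
move=> mu_itv d0; set K := box_radius km kp.
have K0 : 0 < K by exact: box_radius_gt0.
have [L L0 hL] := cumulant_derive_lipschitz mu_itv (`|beta| * (K * K * gam) + `|h|).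
(* The 4 comes from [(a - b)^2 <= 2 a^2 + 2 b^2] applied to two fields near one [d p]; the [+ 1]
   keeps [c] positive when [L * beta] vanishes. *)
pose c := 4 * (L * `|beta|) ^+ 2 + 1.
have c0 : 0 < c by rewrite /c ltr_wpDl // mulr_ge0 // sqr_ge0.
exists (delta ^+ 2 / c); first by rewrite divr_gt0 // exprn_gt0.
move=> N A I d hA hg hd.
pose near p (x : N.-tuple R) := box km kp x /\
  sqn (fun i => local_field A x i - d p i) <= delta ^+ 2 / c * N%:R.
have near_dist p x x' : near p x -> near p x' ->
    l2norm (cond_mean mu A beta h x - cond_mean mu A beta h x') <= delta * Num.sqrt N%:R.
  move=> [bx hx] [bx' hx'].
  rewrite -(ger0_norm (ltW d0)) -sqrtr_sqr -sqrtrM ?sqr_ge0 // ler_wsqrtr //.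
  have hfield (y : N.-tuple R) i : box km kp y ->
      `|beta * local_field A y i + h| <= `|beta| * (K * K * gam) + `|h|.
    move=> by'; apply: (le_trans (ler_normD _ _)); rewrite lerD2r normrM ler_wpM2l //.
    apply: (bil_bound hA (ltW K0) (ltW K0) (hg i)) => j; exact: box_coord_le.
  apply: (@le_trans _ _ ((L * `|beta|) ^+ 2 * (2 * (sqn (fun i => local_field A x i - d p i)
      + sqn (fun i => local_field A x' i - d p i))))).
    rewrite /sqn -big_split /= !mulr_sumr; apply: ler_sum => i _; rewrite !mxE.
    set b := derive1 _ _; set b' := derive1 _ _.
    have hb : `|b - b'| <= L * `|beta| * `|local_field A x i - local_field A x' i|.
      apply: (le_trans (hL _ _ (hfield x i bx) (hfield x' i bx'))).
      rewrite -mulrA ler_wpM2l // -normrM le_eqVlt; apply/orP; left; apply/eqP.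
      by congr (`|_|); ring.
    apply: (@le_trans _ _ ((L * `|beta|) ^+ 2 * (local_field A x i - local_field A x' i) ^+ 2)).
      rewrite -exprMn -real_normK ?num_real // -[leRHS]real_normK ?num_real //.
      rewrite lerXn2r ?nnegrE // (le_trans hb) // normrM ler_wpM2r //.
      by rewrite ler_norm.
    rewrite ler_wpM2l ?sqr_ge0 // -subr_ge0.
    rewrite (_ : _ - _ = (local_field A x i + local_field A x' i - 2 * d p i) ^+ 2) ?sqr_ge0 //.
    by ring.
  have h1 : (L * `|beta|) ^+ 2 * (2 * (sqn (fun i => local_field A x i - d p i)
      + sqn (fun i => local_field A x' i - d p i))) <=
      4 * (L * `|beta|) ^+ 2 * (delta ^+ 2 / c * N%:R).
    rewrite [leRHS](_ : _ = (L * `|beta|) ^+ 2 * (2 * (delta ^+ 2 / c * N%:R + delta ^+ 2 / c * N%:R))); last by ring.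
    by rewrite ler_wpM2l ?sqr_ge0 // ler_pM2l // lerD.
  apply: (le_trans h1).
  have -> : delta ^+ 2 * N%:R = c * (delta ^+ 2 / c * N%:R) by field; rewrite gt_eqF.
  rewrite ler_wpM2r ?lerDl // mulr_ge0 // divr_ge0 ?sqr_ge0 //; exact: ltW.
pose Q p := exists x, near p x.
have [x0 hx0] : exists x0 : I -> N.-tuple R, forall p, Q p -> near p (x0 p).
  have /choice[x0 hx0] p : exists x, Q p -> near p x.
    case: (pselect (Q p)) => [[x hx]|nQ]; first by exists x.
    by exists [tuple 0 | i < N].
  by exists x0.
pose s := [seq cond_mean mu A beta h (x0 p) | p <- enum I & `[< Q p >]].
have memD v : v \in seq_fset tt s -> v \in s by rewrite seq_fsetE.
have memD' v : v \in s -> v \in seq_fset tt s by rewrite seq_fsetE.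
exists (seq_fset tt s); split; last first.
  rewrite size_seq_fset (leq_trans (size_undup _)) // size_map size_filter.
  by rewrite (leq_trans (count_size _ _)) // -cardE.
split.
  move=> v /= /memD /mapP[p]; rewrite mem_filter => /andP[/asboolP hp _] ->.
  by exists (x0 p) => //; case: (hx0 p hp).
move=> _ [x bx <-].
have [p hp] := hd (tnth x) (tnth x) (fun j => box_coord_le j bx) (fun j => box_coord_le j bx).
have nx : near p x by split.
have Qp : Q p by exists x.
exists (cond_mean mu A beta h (x0 p)); last exact: near_dist nx (hx0 p Qp).
by apply: memD'; apply/mapP; exists p => //; rewrite mem_filter mem_enum andbT; apply/asboolP.
Qed.

(** Size bounds come from nets that depend on [eta]. A net of minimal size is a single choice that
    inherits all these bounds. *)
Lemma exists_minimal_net (R : realType) N (S : set 'cV[R]_N) (e : R) :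
  (exists D, l2net S e D) ->
  exists2 D, l2net S e D & forall D', l2net S e D' -> (#|` D| <= #|` D'|)%N.
Proof.
move=> [D0 hD0].
pose P m := `[< exists2 D, l2net S e D & #|` D| = m >].
have exP : exists m, P m by exists #|` D0|; apply/asboolP; exists D0.
case: (ex_minnP exP) => m /asboolP[D hD cD] hm.
by exists D => // D' hD'; rewrite cD; apply: hm; apply/asboolP; exists D'.
Qed.

Lemma degree_sq_littleo (R : realType) (A : forall N : nat, 'I_N -> 'I_N -> 'I_N -> R) :
  (forall N, interaction_tensor (A N)) ->
  (fun N => opnorm (\sum_(i < N) slice (A N) i ^+ 2))
    =o_\oo (fun N => (ln N%:R)^-1 : R) ->
  forall eps, 0 < eps -> \forall N \near \oo, degree_sq (A N) <= eps * N%:R.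
Proof.
move=> hA /eqoP mf eps eps0.
have l2 : 0 < ln 2 :> R by rewrite ln_gt0 // ltr1n.
(* For [N >= 2], [1/ln N <= 1/ln 2], so the little-o constant [eps ln 2] yields the bound [eps]. *)
have e0 : 0 < eps * ln 2 by rewrite mulr_gt0.
near=> N.
have N2 : (2 <= N)%N by near: N; exact: nbhs_infty_ge.
have h : `|opnorm (\sum_(i < N) slice (A N) i ^+ 2)| <= eps * ln 2 * `|(ln N%:R)^-1|.
  by near: N; exact: mf.
apply: (le_trans (degree_sq_opnorm (hA N))); rewrite mulrC ler_wpM2r //.
apply: (le_trans (ler_norm _)); apply: (le_trans h).
have lN : ln 2 <= ln N%:R :> R by apply: ln_nat_le.
have lN0 : 0 < ln N%:R :> R by apply: lt_le_trans lN.
by rewrite gtr0_norm ?invr_gt0 // -mulrA ler_piMr ?(ltW eps0) // ler_pdivrMr // mul1r.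
Unshelve. all: by end_near.
Qed.

Unset Implicit Arguments.
Set Strict Implicit.

Theorem theorem1p10 (R : realType) (km kp : R)
  (mu : probability (measurableTypeR R) R)
  (A : forall N : nat, 'I_N -> 'I_N -> 'I_N -> R)
  (beta h gamma : R)
  (hk : km < kp)
  (mu_itv : mu `[km, kp]%classic = 1%E)
  (km_supp : msupport mu km) (kp_supp : msupport mu kp)
  (hA : forall N, interaction_tensor (A N))
  (gamma_gt0 : 0 < gamma)
  (A_gamma : forall N (i : 'I_N),
    \sum_(j < N) \sum_(k < N) A N i j k <= gamma)
  (mean_field : (fun N => opnorm (\sum_(i < N) slice (A N) i ^+ 2))
    =o_\oo (fun N => (ln N%:R)^-1 : R)) :
  (((ln (partition_function mu (A N) beta h))%:E
      - mean_field_sup mu (A N) beta h km kp) * (N%:R^-1)%:E)%E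
    @[N --> \oo] --> (0 : \bar R)%E
  /\
  (forall delta : R, 0 < delta ->
    exists D : forall N, {fset 'cV[R]_N},
      (forall N, l2net (cond_mean mu (A N) beta h @` box km kp)
                       (delta * Num.sqrt N%:R) (D N)) /\
      (fun N => ln (#|` D N|)%:R) =o_\oo (fun N => N%:R : R)).
Proof.
pose K := box_radius km kp; have K0 : 0 < K by exact: box_radius_gt0.
have degree_small := degree_sq_littleo hA mean_field.
split.
  pose u N : R := (ln (partition_function mu (A N) beta h)
    - fine (mean_field_sup mu (A N) beta h km kp)) * N%:R^-1.
  rewrite (_ : (fun N => _) = EFin \o u); last first.
    apply/funext => N /=; rewrite /u EFinM EFinB fineK //.
    exact: (mean_field_sup_fin_num mu_itv beta h (hA N) (A_gamma N)).
  apply: cvg_EFin; first by near=> N.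
  apply/cvgrPdist_le => eta eta0; rewrite /=.
  have [eps eps0 [N0 hN0]] := mean_field_upper_bound beta h gamma mu_itv eta0.
  near=> N.
  have hd : degree_sq (A N) <= eps * N%:R by near: N; exact: degree_small.
  have NN0 : (N0 <= N)%N by near: N; exact: nbhs_infty_ge.
  have N1 : (1 <= N)%N by near: N; exact: nbhs_infty_ge.
  have Npos : (0 : R) < N%:R by rewrite ltr0n.
  have lo := mean_field_sup_le mu_itv beta h (hA N) (A_gamma N).
  have up := hN0 N (A N) NN0 (hA N) (A_gamma N) hd.
  have fin := mean_field_sup_fin_num mu_itv beta h (hA N) (A_gamma N).
  rewrite -(fineK fin) lee_fin in lo; rewrite -(fineK fin) -EFinD lee_fin in up.
  (* The lower bound on [Z] makes the gap nonnegative, so its absolute value is bounded by the upper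
     bound alone. *)
  rewrite sub0r normrN /u normrM ger0_norm ?subr_ge0 // gtr0_norm ?invr_gt0 //.
  by rewrite ler_pdivrMr // lerBlDl.
move=> delta delta0.
have [tau tau0 net] := cond_mean_net beta h gamma mu_itv delta0.
(* A net is required for every [N], including those where [degree_sq] is not yet small. *)
have net_exists N : exists D,
    l2net (cond_mean mu (A N) beta h @` box km kp) (delta * Num.sqrt N%:R) D.
  have [I [d hd]] := finite_net K0 tau0 (hA N) (A_gamma N).
  by have [D [hD _]] := net N (A N) I d (hA N) (A_gamma N) hd; exists D.
pose D N := s2val (cid2 (exists_minimal_net (net_exists N))).
exists D; split=> [N|]; first by rewrite /D; case: cid2.
apply/eqoP => eta eta0.
have [eps eps0 low] := low_complexity gamma K0 tau0 eta0.
near=> N.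
have hd : degree_sq (A N) <= eps * N%:R by near: N; exact: degree_small.
have [I [d [hI hd']]] := low N (A N) (hA N) (A_gamma N) hd.
have [D' [hD' cD']] := net N (A N) I d (hA N) (A_gamma N) hd'.
have Dmin : (#|` D N| <= #|` D'|)%N by rewrite /D; case: cid2 => D1 hD1 hmin; exact: hmin.
rewrite ger0_norm ?ln_nat_ge0 // (ger0_norm (ler0n _ _)).
by apply: le_trans hI; apply: ln_nat_le; exact: leq_trans cD'.
Unshelve. all: by end_near.
Qed.
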